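(* Every uniformly recurrent morphic sequence is a primitive substitutive sequence.
   Context: A morphic sequence is a sequence $\phi(\sigma^\infty(a))$ where $\sigma:A^*\to A^*$ is an endomorphism over a finite alphabet $A$ prolongable on $a$ (i.e. $\sigma(a)=au$ with $u$ nonempty and $|\sigma^n(a)|\to\infty$, $\sigma^\infty(a)$ being the limit of the words $\sigma^n(a)$), and $\phi:A^*\to B^*$ is a morphism. A uniformly recurrent sequence is one in which every factor occurs infinitely often with bounded gaps between successive occurrences. A substitution is an endomorphism $\sigma$ that is prolongable on some letter and growing, i.e. $\min_{b\in A}|\sigma^n(b)|\to\infty$. It is primitive if its incidence matrix $M_\sigma=(m_{i,j})$ ($m_{i,j}$ = number of occurrences of the letter $i$ in $\sigma(j)$) has a power with all entries strictly positive. A coding is a letter-to-letter morphism $\phi:A^*\to B^*$ with $\phi(A)=B$. A sequence is primitive substitutive if it equals $\phi(\sigma^\infty(a))$ for a primitive substitution $\sigma$ prolongable on $a$ and a coding $\phi$. *)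

(* Defs.v *)
From HB Require Import structures.
From mathcomp Require Import all_boot all_order all_algebra.

Set Implicit Arguments.
Unset Strict Implicit.
Unset Printing Implicit Defensive.

(* A morphism of free monoids [seq A -> seq B] is given by the images
   [f : A -> seq B] of the letters; [ext f] is the morphism itself. *)
Definition ext (A B : Type) (f : A -> seq B) (w : seq A) : seq B :=
  flatten (map f w).

Definition iter_word (A : Type) (s : A -> seq A) (n : nat) (a : A) : seq A :=
  iter n (ext s) [:: a].

(* The words [u n] converge to the infinite sequence [x]: every finite prefix
   of [x] is eventually a prefix of [u n]. *)
Definition word_limit (A : Type) (u : nat -> seq A) (x : nat -> A) : Prop :=
  forall k, exists n0, forall n, n0 <= n ->
    k <= size (u n) /\ take k (u n) = mkseq x k.

Definition prolongable (A : Type) (s : A -> seq A) (a : A) : Prop :=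
  (exists u, u <> [::] /\ s a = a :: u) /\
  (forall N, exists n0, forall n, n0 <= n -> N <= size (iter_word s n a)).

Definition sigma_infty (A : Type) (s : A -> seq A) (a : A) (y : nat -> A) : Prop :=
  word_limit (fun n => iter_word s n a) y.

(* [x] is the image of the infinite sequence [y] under [phi]; since [x] is
   infinite, this excludes a [phi] that erases all but finitely many terms. *)
Definition image_seq (A B : Type) (phi : A -> seq B)
    (y : nat -> A) (x : nat -> B) : Prop :=
  word_limit (fun n => ext phi (mkseq y n)) x.

Definition morphic (B : finType) (x : nat -> B) : Prop :=
  exists (A : finType) (s : A -> seq A) (a : A) (phi : A -> seq B)
         (y : nat -> A),
    [/\ prolongable s a, sigma_infty s a y & image_seq phi y x].

Definition occurs_at (B : Type) (w : seq B) (x : nat -> B) (i : nat) : Prop :=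
  mkseq (fun k => x (i + k)) (size w) = w.

Definition factor (B : Type) (w : seq B) (x : nat -> B) : Prop :=
  exists i, occurs_at w x i.

Definition uniformly_recurrent (B : Type) (x : nat -> B) : Prop :=
  forall w, factor w x ->
    (forall N, exists2 i, N <= i & occurs_at w x i) /\
    (exists g, forall i j, i < j -> occurs_at w x i -> occurs_at w x j ->
       (forall k, i < k < j -> ~ occurs_at w x k) -> j - i <= g).

Definition growing (A : Type) (s : A -> seq A) : Prop :=
  forall N, exists n0, forall n, n0 <= n ->
    forall b, N <= size (iter_word s n b).

Definition substitution (A : Type) (s : A -> seq A) : Prop :=
  (exists b, prolongable s b) /\ growing s.

Definition incidence (A : finType) (s : A -> seq A) : 'M[nat]_#|A| :=
  (\matrix_(i, j) count_mem (enum_val i) (s (enum_val j)))%R.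

Definition primitive (A : finType) (s : A -> seq A) : Prop :=
  exists2 k, 0 < k & forall i j, 0 < (incidence s ^+ k)%R i j.

(* A coding onto the alphabet [C], a subset of the ambient alphabet [B]. *)
Definition coding (A B : finType) (phi : A -> seq B) (C : {set B}) : Prop :=
  (forall a, size (phi a) = 1) /\
  (forall b, b \in C <-> exists a, phi a = [:: b]).

(* A sequence over [B] need not use all letters of [B], while a coding is onto
   its alphabet; hence the alphabet [C] of the coding is a subset of [B]. *)
Definition primitive_substitutive (B : finType) (x : nat -> B) : Prop :=
  exists (A : finType) (C : {set B}) (s : A -> seq A) (a : A)
         (phi : A -> seq B) (y : nat -> A),
    [/\ substitution s /\ primitive s, prolongable s a, coding phi C,
        sigma_infty s a y & image_seq phi y x].

(* Main.v *)
(* Write [x = phi (y)] with [y] the fixed point of [s] from [a], and compare the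
   words [phi (s^n b)] for the letters [b] of [y]. Either [x] is purely periodic,
   or it is linearly recurrent: a letter with a minimal set of descendants
   generates a primitive piece of [s], and by uniform recurrence every factor of
   [x] is seen in its images. Linear recurrence bounds the number of occurrences
   of a word in a window of comparable length, and this forces the letters whose
   images are negligible with respect to [phi (s^n a)] to form runs of bounded
   length in [y]. Therefore, for infinitely many [n], the sequence [x] coded by
   the return words to its prefix [phi (s^n a)] is obtained from [y] by a sliding
   block rule taken from a finite set, and two exponents [n < m] give the same
   coded sequence. Rewriting the return words for [m] in terms of those for [n]
   gives a primitive substitution fixing that sequence, and expanding each return
   word into its positions turns it into one whose coding is [x]. *)

Require Import Defs.
From HB Require Import structures.
From mathcomp Require Import all_boot all_order all_algebra.
From mathcomp Require Import zify.
From Stdlib Require Import Classical_Prop.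

Set Implicit Arguments.
Unset Strict Implicit.
Unset Printing Implicit Defensive.

(** The obstacle is that [s] need not be primitive: letters of [y] may grow at incomparable rates,
    or not at all, so a window of fixed length in [y] may cover a negligible part of [x] at scale
    [n]. This is why runs are bounded twice. For stationary letters, long runs would create high
    powers of a word; this bound is needed to prove linear recurrence. For small letters, linear
    recurrence itself is the tool. Once small runs are bounded, a fixed number of consecutive
    letters of [y] covers, at every admissible scale [n], the length one must look ahead to find the
    next return word, and every block [phi (s^n b)] meets boundedly many return words: hence
    finitely many sliding block rules. The exponent [m] is taken far beyond [n], so that each return
    word for [m] contains all those for [n]; this gives primitivity and also leaves room for
    expanding return words into positions. The purely periodic case is separate, because there the
    occurrences of long prefixes do not become sparse. *)

(** * Morphisms of free monoids and their iterates *)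

Lemma ext_cat (A B : Type) (f : A -> seq B) u v :
  ext f (u ++ v) = ext f u ++ ext f v.
Proof. by rewrite /ext map_cat flatten_cat. Qed.

Lemma ext_cons (A B : Type) (f : A -> seq B) b w :
  ext f (b :: w) = f b ++ ext f w.
Proof. by []. Qed.

Lemma ext_rcons (A B : Type) (f : A -> seq B) w b :
  ext f (rcons w b) = ext f w ++ f b.
Proof. by rewrite -cats1 ext_cat /ext /= cats0. Qed.

Lemma ext_seq1 (A B : Type) (f : A -> seq B) b : ext f [:: b] = f b.
Proof. by rewrite /ext /= cats0. Qed.

Lemma eq_ext (A B : Type) (f g : A -> seq B) : f =1 g -> ext f =1 ext g.
Proof. by move=> fg w; rewrite /ext (eq_map fg). Qed.

Lemma ext_comp (A B C : Type) (f : B -> seq C) (g : A -> seq B) w :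
  ext f (ext g w) = ext (fun b => ext f (g b)) w.
Proof. by elim: w => // b w IH; rewrite !ext_cons ext_cat IH. Qed.

Lemma iter_ext_cat (A : Type) (s : A -> seq A) n u v :
  iter n (ext s) (u ++ v) = iter n (ext s) u ++ iter n (ext s) v.
Proof. by elim: n => //= n ->; rewrite ext_cat. Qed.

Lemma iter_ext_nil (A : Type) (s : A -> seq A) n : iter n (ext s) [::] = [::].
Proof. by elim: n => //= n ->. Qed.

Lemma iter_ext (A : Type) (s : A -> seq A) n w :
  iter n (ext s) w = ext (iter_word s n) w.
Proof.
elim: w => [|b w IH]; first by rewrite iter_ext_nil.
by rewrite -cat1s iter_ext_cat IH.
Qed.

Lemma iter_wordS (A : Type) (s : A -> seq A) n b :
  iter_word s n.+1 b = iter n (ext s) (s b).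
Proof. by rewrite /iter_word iterSr ext_seq1. Qed.

Lemma iter_word_comp (A : Type) (s : A -> seq A) p n w :
  iter n (ext (iter_word s p)) w = iter (n * p) (ext s) w.
Proof.
elim: n => //= n ->.
by rewrite -iter_ext -iterD mulSn.
Qed.

Lemma mem_ext (A B : eqType) (f : A -> seq B) w c :
  reflect (exists2 b, b \in w & c \in f b) (c \in ext f w).
Proof. exact: flatten_mapP. Qed.

Lemma infix_mem_ext (A B : eqType) (f : A -> seq B) b w :
  b \in w -> infix (f b) (ext f w).
Proof. by case/splitPr => p q; rewrite ext_cat ext_cons infix_infix. Qed.

Lemma infix_ext (A B : eqType) (f : A -> seq B) u v :
  infix u v -> infix (ext f u) (ext f v).
Proof. by case/infixP=> p [q ->]; rewrite !ext_cat infix_infix. Qed.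

Lemma prefix_ext (A B : eqType) (f : A -> seq B) u v :
  prefix u v -> prefix (ext f u) (ext f v).
Proof. by case/prefixP=> q ->; rewrite ext_cat prefix_prefix. Qed.

Lemma infix_iter_ext (A : eqType) (s : A -> seq A) n u v :
  infix u v -> infix (iter n (ext s) u) (iter n (ext s) v).
Proof. by rewrite !iter_ext; exact: infix_ext. Qed.

Lemma prefix_iter_ext (A : eqType) (s : A -> seq A) n u v :
  prefix u v -> prefix (iter n (ext s) u) (iter n (ext s) v).
Proof. by rewrite !iter_ext; exact: prefix_ext. Qed.

Lemma size_ext_ge (A B : Type) (f : A -> seq B) w :
  (forall b, 0 < size (f b)) -> size w <= size (ext f w).
Proof.
move=> f0; elim: w => //= b w IH; rewrite ext_cons size_cat.
by have := f0 b; lia.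
Qed.

Lemma size_ext_le (A B : Type) (f : A -> seq B) k w :
  (forall b, size (f b) <= k) -> size (ext f w) <= k * size w.
Proof.
move=> f0; elim: w => //= b w IH; rewrite ext_cons size_cat.
by have := f0 b; lia.
Qed.

Lemma size_iter_ext_ge (A : Type) (s : A -> seq A) n w :
  (forall b, 0 < size (s b)) -> size w <= size (iter n (ext s) w).
Proof.
move=> s0; elim: n => //= n IH; exact: leq_trans IH (size_ext_ge _ s0).
Qed.

Lemma size_iter_word_prolongable (A : Type) (s : A -> seq A) a u n :
  (forall b, 0 < size (s b)) -> s a = a :: u -> 0 < size u ->
  n < size (iter_word s n a).
Proof.
move=> s0 sa u0; elim: n => // n IH.
rewrite iter_wordS sa -cat1s iter_ext_cat size_cat.
by have := size_iter_ext_ge n u s0; rewrite /iter_word in IH *; lia.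
Qed.

Lemma prefix_iter_word (A : eqType) (s : A -> seq A) a u m n :
  s a = a :: u -> m <= n -> prefix (iter_word s m a) (iter_word s n a).
Proof.
move=> sa /subnK <-; elim: (n - m) => [|k IH]; first exact: prefix_refl.
apply: prefix_trans IH _; rewrite addSn iter_wordS sa -cat1s iter_ext_cat.
exact: prefix_prefix.
Qed.

Lemma iter_word_mem (A : finType) (s : A -> seq A) b c k :
  c \in s b -> infix (iter_word s k c) (iter_word s k.+1 b).
Proof.
by move=> cb; rewrite iter_wordS iter_ext; exact: infix_mem_ext.
Qed.

(** * Prefixes of infinite sequences and fixed points *)

Definition prefix_of (B : Type) (w : seq B) (x : nat -> B) : Prop :=
  mkseq x (size w) = w.

Lemma prefix_of_prefix (B : eqType) (v w : seq B) x :
  prefix v w -> prefix_of w x -> prefix_of v x.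
Proof.
case/prefixP=> u -> ; rewrite /prefix_of size_cat /mkseq iotaD map_cat.
by move/eqP; rewrite eqseq_cat ?size_map ?size_iota // => /andP[/eqP].
Qed.

Lemma prefix_of_comparable (B : eqType) (v w : seq B) x :
  prefix_of v x -> prefix_of w x -> size v <= size w -> prefix v w.
Proof.
move=> <- <-; rewrite !size_mkseq => /subnKC <-.
by rewrite /mkseq iotaD map_cat prefix_prefix.
Qed.

Lemma prefix_of_takeE (B : eqType) (w : seq B) x k :
  prefix_of w x -> k <= size w -> take k w = mkseq x k.
Proof.
move=> <-; rewrite size_mkseq => kw.
by rewrite /mkseq -map_take take_iota (minn_idPl kw).
Qed.

(** For nonerasing [s] with [s a = a u], [u] nonempty, the [i]-th iterate has more than [i] letters,
    so the default value is never read. *)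
Definition fixpoint (A : Type) (s : A -> seq A) (a : A) (i : nat) : A :=
  nth a (iter_word s i a) i.

Lemma prefix_of_fixpoint (A : eqType) (s : A -> seq A) a u n :
  (forall b, 0 < size (s b)) -> s a = a :: u -> 0 < size u ->
  prefix_of (iter_word s n a) (fixpoint s a).
Proof.
move=> s0 sa u0; apply: (@eq_from_nth _ a); rewrite size_mkseq // => i ilt.
rewrite nth_mkseq // /fixpoint.
have ii := size_iter_word_prolongable i s0 sa u0.
case: (leqP i n) => [|/ltnW] h.
  by have /prefixP[v ->] := prefix_iter_word sa h; rewrite nth_cat ii.
by have /prefixP[v ->] := prefix_iter_word sa h; rewrite nth_cat ilt.
Qed.

(** * A criterion for primitive substitutivity *)

Lemma incidence_sqr_gt0 (A : finType) (s : A -> seq A) :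
  (forall b c, exists2 d, d \in s b & c \in s d) ->
  forall i j, 0 < (incidence s ^+ 2)%R i j.
Proof.
move=> h i j.
have [d db cd] := h (enum_val j) (enum_val i).
rewrite GRing.expr2 !mxE (bigD1 (enum_rank d)) //= !mxE.
rewrite enum_rankK ltn_addr // muln_gt0 -!has_count.
by rewrite !has_pred1 cd db.
Qed.

(* The letters of the new alphabet are the positions in the words [th q], so that
   [th] becomes a coding; since [size (th q) <= size (t q)], the letters of [t q]
   can be distributed over these positions. *)
Section DecoratedSubstitution.

Variables (B Q : finType) (d0 : Q) (t : Q -> seq Q) (th : Q -> seq B).
Hypothesis th_gt0 : forall q, 0 < size (th q).
Hypothesis th_le : forall q, size (th q) <= size (t q).
Hypothesis t_gt1 : forall q, 1 < size (t q).
Hypothesis t_full : forall q q', q' \in t q.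

Let F : finType := {q : Q & 'I_(size (th q))}.

Let spell (q : Q) : seq F :=
  [seq Tagged (fun q => 'I_(size (th q))) i | i <- enum 'I_(size (th q))].

(** Each position but the last receives one letter of [t q], and the last receives all the rest, so
    [spell] intertwines [t] and [sub]. By [th_le] the share of the last position is nonempty. *)
Let sub (c : F) : seq F :=
  let: existT q i := c in
  if i.+1 < size (th q) then spell (nth q (t q) i) else ext spell (drop i (t q)).

(** Cutting out a word of length one avoids a default letter in [B]. *)
Let letter (c : F) : seq B :=
  let: existT q i := c in take 1 (drop i (th q)).

Let size_spell q : size (spell q) = size (th q).
Proof. by rewrite size_map size_enum_ord. Qed.

Let spell_gt0 q : 0 < size (spell q).
Proof. by rewrite size_spell. Qed.

Let ext_letter_spell q : ext letter (spell q) = th q.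
Proof.
have [b _] : exists b, b \in th q.
  by move: (th_gt0 q); case: (th q) => // b w; exists b; exact: mem_head.
rewrite /ext /spell -map_comp -[RHS](mkseq_nth b) /mkseq -val_enum_ord -map_comp.
elim: (enum _) => //= i l ->; by rewrite (drop_nth b) //= take0.
Qed.

Let sub_gt0 c : 0 < size (sub c).
Proof.
case: c => q i /=; case: ifP => // _.
apply: leq_trans (size_ext_ge _ spell_gt0); rewrite size_drop.
by have := th_le q; have := ltn_ord i; lia.
Qed.

Let ext_take_spell q k : k < size (th q) ->
  ext sub (take k (spell q)) = ext spell (take k (t q)).
Proof.
elim: k => [|k IH] lk; first by rewrite !take0.
have lt' : k < size (t q) by have := th_le q; lia.
have c0 : F by exact: Tagged (Ordinal (th_gt0 q)).
rewrite (take_nth c0) ?size_spell ?(take_nth q) ?(ltnW lk) //.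
rewrite !ext_rcons IH ?(ltnW lk) //; congr (_ ++ _).
rewrite /spell (nth_map (Ordinal (th_gt0 q))) ?size_enum_ord ?(ltnW lk) //=.
by rewrite nth_enum_ord ?(ltnW lk) // lk.
Qed.

Let ext_sub_spell q : ext sub (spell q) = ext spell (t q).
Proof.
have c0 : F by exact: Tagged (Ordinal (th_gt0 q)).
set k := (size (th q)).-1.
have kE : size (th q) = k.+1 by rewrite /k prednK.
rewrite -[spell q](cat_take_drop k) ext_cat ext_take_spell ?kE //.
rewrite (drop_nth c0) ?size_spell ?kE // drop_oversize ?size_spell ?kE //.
rewrite ext_seq1 /spell (nth_map (Ordinal (th_gt0 q))) ?size_enum_ord ?kE //=.
by rewrite nth_enum_ord ?kE // ltnn -ext_cat cat_take_drop.
Qed.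

Let mem_spell (c : F) : c \in spell (tag c).
Proof. by case: c => q i; apply: map_f; rewrite mem_enum. Qed.

(** One step produces a whole word [spell q]; the next turns it into the spelling of [t q], which
    contains every letter by [t_full]. *)
Let full2 b c : exists2 d, d \in sub b & c \in sub d.
Proof.
have [q hq] : exists q, {subset spell q <= sub b}.
  case: b => q i /=; case: ifP => [_|h]; first by exists (nth q (t q) i).
  have li : i < size (t q) by apply: leq_trans (ltn_ord i) (th_le q).
  exists (nth q (t q) i); rewrite (drop_nth q) // ext_cons => d dq.
  by rewrite mem_cat dq.
have : c \in ext sub (spell q).
  rewrite ext_sub_spell; apply/mem_ext.
  by exists (tag c); [exact: t_full | exact: mem_spell].
by case/mem_ext=> d dq cd; exists d => //; exact: hq.
Qed.

Lemma decorated_primitive_substitutive (x : nat -> B) u :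
  t d0 = d0 :: u -> (forall n, prefix_of (ext th (iter_word t n d0)) x) ->
  primitive_substitutive x.
Proof.
move=> td0 xpre.
pose a : F := Tagged (fun q => 'I_(size (th q))) (Ordinal (th_gt0 d0)).
have [v va] : exists v, spell d0 = a :: v.
  rewrite /spell; move: (mem_enum 'I_(size (th d0)) (Ordinal (th_gt0 d0))).
  case E: (enum _) => [//|i l] _.
  exists [seq Tagged (fun q => 'I_(size (th q))) i | i <- l].
  rewrite /= /a; congr (Tagged _ _ :: _); apply/val_inj => /=.
  by rewrite -[i]/(nth i (i :: l) 0) -E nth_enum_ord.
have [w [w0 sa]] : exists w, 0 < size w /\ sub a = a :: w.
  rewrite /sub /a; case: ifP => h.
    rewrite td0 /= va; exists v; split=> //.
    by have := size_spell d0; rewrite va /=; move: h => /=; lia.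
  rewrite drop0 td0 ext_cons va /=; exists (v ++ ext spell u); split=> //.
  rewrite size_cat; have := size_ext_ge u spell_gt0.
  by have := t_gt1 d0; rewrite td0 /=; lia.
have pa n : prefix (ext letter (iter_word sub n a)) (ext th (iter_word t n d0)).
  have -> : ext th (iter_word t n d0) = ext letter (iter n (ext sub) (spell d0)).
    have -> : iter n (ext sub) (spell d0) = ext spell (iter_word t n d0).
      elim: n => [|n IH]; first by rewrite /= ext_seq1.
      rewrite iterS IH ext_comp (eq_ext ext_sub_spell) -ext_comp.
      by rewrite /iter_word.
    by rewrite ext_comp (eq_ext ext_letter_spell).
  by rewrite va -cat1s iter_ext_cat ext_cat prefix_prefix.
have growa n : n < size (iter_word sub n a).
  exact: size_iter_word_prolongable sub_gt0 sa w0.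
have prol : prolongable sub a.
  split; first by exists w; split=> //; case: (w) w0.
  by move=> N; exists N => n Nn; apply: leq_trans Nn (ltnW (growa n)).
have size1 c : size (letter c) = 1.
  by case: c => q i; rewrite /= size_takel // size_drop; have := ltn_ord i; lia.
exists F, [set b | [exists c, letter c == [:: b]]], sub, a, letter, (fixpoint sub a).
split.
- split; last by exists 2 => // i j; exact: incidence_sqr_gt0.
  split; first by exists a.
  move=> N; exists N.+2 => -[|[|n]] // Nn b.
  have [d db ad] := full2 b a.
  have h1 := iter_word_mem n.+1 db; have h2 := iter_word_mem n ad.
  apply: leq_trans (size_infix (infix_trans h2 h1)).
  by apply: leq_trans (ltnW (growa n)); rewrite -2!ltnS.
- exact: prol.
- split=> // b; rewrite inE; split.
    by case/existsP=> c /eqP h; exists c.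
  by case=> c h; apply/existsP; exists c; apply/eqP.
- move=> k; exists k => n kn.
  have h : k <= size (iter_word sub n a) by exact: leq_trans kn (ltnW (growa n)).
  split=> //; apply: prefix_of_takeE => //.
  exact: prefix_of_fixpoint sub_gt0 sa w0.
- move=> k; exists k => n kn.
  have hx : prefix_of (ext letter (mkseq (fixpoint sub a) n)) x.
    apply: prefix_of_prefix (xpre n); apply: prefix_trans (pa n).
    apply: prefix_ext.
    apply: (@prefix_of_comparable _ _ _ (fixpoint sub a)).
    - by rewrite /prefix_of size_mkseq.
    - exact: prefix_of_fixpoint sub_gt0 sa w0.
    - by rewrite size_mkseq ltnW.
  have hs : k <= size (ext letter (mkseq (fixpoint sub a) n)).
    apply: leq_trans (size_ext_ge _ _) => [|c]; rewrite ?size1 //.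
    by rewrite size_mkseq.
  by split=> //; exact: prefix_of_takeE.
Qed.

End DecoratedSubstitution.

(** * Normal form of a morphic sequence *)

(** The orbit of [z] is eventually periodic; any positive multiple of the period that is not below
    the preperiod will do. *)
Lemma iter_idempotent_power (T : finType) (g : T -> T) (z : T) :
  exists2 p, 0 < p & iter (p + p) g z = iter p g z.
Proof.
have [i [t t0 it]] : exists i, exists2 t, 0 < t & iter (i + t) g z = iter i g z.
  have /injectivePn[/= i [j ij eij]] :
      ~~ injectiveb (fun k : 'I_#|T|.+1 => iter k g z).
    by apply/injectiveP=> /leq_card; rewrite card_ord ltnn.
  wlog lij : i j ij eij / i < j.
    move=> H; case: (ltngtP i j) => [|h|/val_inj h]; first exact: H.
      by apply: (H j i) => //; rewrite eq_sym.
    by rewrite h eqxx in ij.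
  exists i; exists (j - i); first by rewrite subn_gt0.
  by rewrite subnKC // ltnW.
have per n k : i <= n -> iter (n + k * t) g z = iter n g z.
  move=> /subnK <-; elim: k => [|k IH]; first by rewrite addn0.
  rewrite -[RHS]IH mulSn.
  have -> : n - i + i + (t + k * t) = (n - i + k * t) + (i + t) by lia.
  have -> : n - i + i + k * t = (n - i + k * t) + i by lia.
  by rewrite iterD it -iterD.
by exists (i.+1 * t); [rewrite muln_gt0 | apply: per; nia].
Qed.

Lemma idempotent_alphabet_power (A : finType) (s : A -> seq A) :
  exists2 p, 0 < p & forall b, iter_word s (p + p) b =i iter_word s p b.
Proof.
(* [g] acts on families of alphabets in such a way that [iter n g z] lists the alphabets of the
   words [s^n b]. *)
pose g (f : {ffun A -> {set A}}) := [ffun b => \bigcup_(c in f b) [set d in s c]].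
pose z := [ffun b : A => [set b]].
have gE n b : iter n g z b = [set c in iter_word s n b].
  elim: n => [|n IH]; first by apply/setP=> c; rewrite ffunE !inE.
  rewrite iterS ffunE IH; apply/setP=> d; rewrite inE /iter_word iterS.
  apply/bigcupP/mem_ext => [[c]|[c]]; rewrite ?inE => cb; last first.
    by move=> dc; exists c; rewrite ?inE.
  by move=> dc; exists c.
have [p p0 pp] := iter_idempotent_power g z; exists p => // b c.
have := congr1 (fun f : {ffun A -> {set A}} => c \in f b) pp.
by rewrite !gE !inE.
Qed.

Definition alphabet_idempotent (A : finType) (s : A -> seq A) : Prop :=
  forall b, ext s (s b) =i s b.

Lemma alphabet_idempotent_iter (A : finType) (s : A -> seq A) :
  alphabet_idempotent s -> forall n b, iter_word s n.+1 b =i s b.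
Proof.
move=> idem n b; elim: n => [|n IH] c; first by rewrite /iter_word /= ext_seq1.
rewrite -[RHS]idem /iter_word iterS -/(iter_word s n.+1 b).
apply/mem_ext/mem_ext => -[d db cd]; exists d => //; first by rewrite -IH.
by rewrite IH.
Qed.

Record normal_form (A B : finType) (s : A -> seq A) (phi : A -> seq B)
    (a : A) (u : seq A) (x : nat -> B) : Prop := NormalForm {
  nf_gt0 : forall b, 0 < size (s b);
  nf_phi_gt0 : forall b, 0 < size (phi b);
  nf_start : s a = a :: u;
  nf_u_gt0 : 0 < size u;
  nf_idem : alphabet_idempotent s;
  nf_prefix : forall n, prefix_of (ext phi (iter_word s n a)) x
}.

Lemma morphic_prefixes (A B : eqType) (s : A -> seq A) a (phi : A -> seq B) y x :
  prolongable s a -> sigma_infty s a y -> image_seq phi y x ->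
  (forall n, prefix_of (ext phi (iter_word s n a)) x) /\
  (forall k, exists n, k <= size (ext phi (iter_word s n a))).
Proof.
move=> [[u [_ sa]] grow] lim_y lim_x.
have py n : prefix_of (iter_word s n a) y.
  have [n0 /(_ (n + n0) (leq_addl _ _))[_]] := lim_y (size (iter_word s n a)).
  have /prefixP[v ->] := prefix_iter_word sa (leq_addr n0 n).
  by rewrite take_size_cat.
have px n : prefix_of (ext phi (mkseq y n)) x.
  have [n0 /(_ (n + n0) (leq_addl _ _))[_]] := lim_x (size (ext phi (mkseq y n))).
  by rewrite [mkseq y (n + n0)]/mkseq iotaD map_cat ext_cat take_size_cat.
split=> [n|k]; first by rewrite -(py n).
have [n0 /(_ n0 (leqnn _))[kn0 _]] := lim_x k.
have [n1 /(_ n1 (leqnn _)) hn1] := grow n0; exists n1.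
apply: leq_trans kn0 _; apply: size_prefix; apply: prefix_ext.
by apply: (@prefix_of_comparable _ _ _ y); rewrite ?size_mkseq ///prefix_of size_mkseq.
Qed.

(* Passing to a power makes the set of letters of [s^n b] independent of
   [n > 0]; then a letter whose image under [phi \o s] is empty has empty image
   under every [phi \o s^n], and such letters can be deleted. To stay on the
   same type, deleted letters are kept as fixed letters that never occur. *)
Lemma morphic_normal_form (B : finType) (x : nat -> B) :
  morphic x ->
  exists (A : finType) (s : A -> seq A) (phi : A -> seq B) (a : A) (u : seq A),
    normal_form s phi a u x.
Proof.
move=> [A [s0 [a [phi0 [y [prol lim_y lim_x]]]]]].
have [pre unb] := morphic_prefixes prol lim_y lim_x.
have [[u0 [u0n s0a]] _] := prol.
have [p p_gt0 pp] := idempotent_alphabet_power s0.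
pose s1 := iter_word s0 p; pose phi1 b := ext phi0 (s1 b).
have idem1 : alphabet_idempotent s1.
  by move=> b c; rewrite -[RHS]pp /s1 -iter_ext /iter_word -iterD.
have phi1E n b : ext phi1 (iter_word s1 n b) = ext phi0 (iter_word s1 n.+1 b).
  by rewrite /phi1 -ext_comp /iter_word iterS.
have iter1 n b : iter_word s1 n b = iter_word s0 (n * p) b.
  by rewrite /iter_word iter_word_comp.
have pre1 n : prefix_of (ext phi1 (iter_word s1 n a)) x.
  by rewrite phi1E iter1; exact: pre.
have unb1 k : exists n, k <= size (ext phi1 (iter_word s1 n a)).
  have [n kn] := unb k; exists n; apply: leq_trans kn _.
  rewrite phi1E iter1; apply: size_prefix; apply: prefix_ext.
  apply: prefix_iter_word s0a _; nia.
pose Z b := phi1 b == [::].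
have null_ext (C : eqType) (f : A -> seq C) w :
    (ext f w == [::]) = all (fun b => f b == [::]) w.
  by elim: w => //= b w <-; rewrite ext_cons; case: (f b).
have ZE b n : (ext phi1 (iter_word s1 n b) == [::]) = Z b.
  rewrite phi1E /Z /phi1 !null_ext.
  by apply: eq_all_r; exact: alphabet_idempotent_iter.
have Zs b : Z b = all Z (s1 b).
  by rewrite -(ZE b 1) null_ext /iter_word /= ext_seq1.
pose pi := filter (fun b => ~~ Z b).
have pi_cat v w : pi (v ++ w) = pi v ++ pi w by exact: filter_cat.
pose s2 b := if Z b then [:: b] else pi (s1 b).
(* The value on deleted letters is arbitrary but must be nonempty; these letters do not occur in the
   iterates of [a] under [s2]. *)
pose phi2 b := if Z b then [:: x 0] else phi1 b.
have pis w : ext s2 (pi w) = pi (ext s1 w).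
  elim: w => //= b w IH; rewrite [ext s1 _]ext_cons pi_cat -IH.
  case: ifP => Zb; first by rewrite ext_cons /s2 (negbTE Zb).
  rewrite [pi (s1 b)](_ : _ = [::]) //; apply/eqP; rewrite -size_eq0 size_filter.
  rewrite -leqn0 leqNgt -has_count; apply/hasPn=> c cb.
  by move/negbFE: Zb; rewrite Zs negbK => /allP; apply.
have piphi w : ext phi2 (pi w) = ext phi1 w.
  elim: w => //= b w IH; rewrite ext_cons; case: ifP => Zb.
    by rewrite ext_cons IH /phi2 (negbTE Zb).
  by rewrite IH; move/negbFE: Zb => /eqP ->.
have Za : ~~ Z a.
  apply/negP=> Za; have [n] := unb1 1.
  by move: Za; rewrite -(ZE a n) => /eqP ->.
have it2 n : iter_word s2 n a = pi (iter_word s1 n a).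
  elim: n => [|n IH]; first by rewrite /= Za.
  by rewrite /iter_word iterS -/(iter_word s2 n a) IH pis.
have /prefixP[u1 s1a] : prefix [:: a] (s1 a).
  exact: (prefix_iter_word s0a (leq0n p)).
have s2a : s2 a = a :: pi u1 by rewrite /s2 (negbTE Za) s1a /= Za.
exists A, s2, phi2, a, (pi u1); split=> //.
- move=> b; rewrite /s2; case: ifP => // Zb.
  rewrite size_filter -has_count; move: Zb; rewrite Zs => /negbT.
  by rewrite -has_predC.
- by move=> b; rewrite /phi2; case: ifP => // /negbT; rewrite lt0n size_eq0.
- rewrite lt0n; apply/negP=> /eqP/size0nil u10.
  have fix2 n : iter_word s2 n a = [:: a].
    elim: n => // n IH.
    by rewrite /iter_word iterS -/(iter_word s2 n a) IH ext_seq1 s2a u10.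
  have [n] := unb1 (size (phi2 a)).+1.
  by rewrite -piphi -it2 fix2 ext_seq1 ltnn.
- move=> b c; case Zb: (Z b); first by rewrite /s2 Zb ext_seq1 Zb.
  apply/mem_ext/idP => [[d]|].
    rewrite {1 3}/s2 Zb !mem_filter => /andP[Zd db].
    rewrite /s2 (negbTE Zd) mem_filter => /andP[-> cd] /=.
    by rewrite -idem1; apply/mem_ext; exists d.
  rewrite /s2 Zb mem_filter => /andP[Zc]; rewrite -idem1 => /mem_ext[d db cd].
  have Zd : ~~ Z d by apply: contra Zc; rewrite Zs => /allP; apply.
  by exists d; rewrite ?mem_filter ?(negbTE Zd) ?mem_filter ?Zd ?Zc.
- by move=> n; rewrite it2 piphi.
Qed.

(** * Growth of letters *)

Definition image_len (A B : Type) (s : A -> seq A) (phi : A -> seq B) n w :=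
  size (ext phi (iter n (ext s) w)).

Section ImageLength.

Variables (A : finType) (B : Type) (s : A -> seq A) (phi : A -> seq B).
Local Notation len := (image_len s phi).

Lemma image_len_cat n v w : len n (v ++ w) = len n v + len n w.
Proof. by rewrite /image_len iter_ext_cat ext_cat size_cat. Qed.

Lemma image_len_cons n b w : len n (b :: w) = len n [:: b] + len n w.
Proof. by rewrite -cat1s image_len_cat. Qed.

Lemma image_len_nil n : len n [::] = 0.
Proof. by rewrite /image_len iter_ext_nil. Qed.

Lemma image_lenS n w : len n.+1 w = len n (ext s w).
Proof. by rewrite /image_len iterSr. Qed.

Lemma image_lenS1 n b : len n.+1 [:: b] = len n (s b).
Proof. by rewrite image_lenS ext_seq1. Qed.

Lemma image_len_infix n v w : infix v w -> len n v <= len n w.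
Proof. by case/infixP=> p [q ->]; rewrite !image_len_cat; lia. Qed.

Lemma image_len_mem n b w : b \in w -> len n [:: b] <= len n w.
Proof. by move=> bw; apply: image_len_infix; rewrite infix1s. Qed.

Lemma image_len_bound n w k :
  {in w, forall b, len n [:: b] <= k} -> len n w <= k * size w.
Proof.
elim: w => [|b w IH] h; first by rewrite image_len_nil.
rewrite image_len_cons /= mulnS; apply: leq_add; first by apply: h; exact: mem_head.
by apply: IH => c cw; apply: h; rewrite inE cw orbT.
Qed.

Lemma image_len_le_words n m w :
  {in w, forall b, len n [:: b] <= len m [:: b]} -> len n w <= len m w.
Proof.
elim: w => [|b w IH] h; first by rewrite !image_len_nil.
rewrite (image_len_cons n b) (image_len_cons m b); apply: leq_add.
  by apply: h; exact: mem_head.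
by apply: IH => c cw; apply: h; rewrite inE cw orbT.
Qed.

Lemma image_len_lt_words n m w d :
  {in w, forall b, len n [:: b] <= len m [:: b]} ->
  d \in w -> len n [:: d] < len m [:: d] -> len n w < len m w.
Proof.
move=> h dw; move: h; case/splitPr: dw => p q h hd.
rewrite !image_len_cat (image_len_cons n d) (image_len_cons m d).
have hp : len n p <= len m p.
  by apply: image_len_le_words => c cp; apply: h; rewrite mem_cat cp.
have hq : len n q <= len m q.
  by apply: image_len_le_words => c cp; apply: h; rewrite mem_cat inE cp !orbT.
lia.
Qed.

Hypothesis s_gt0 : forall b, 0 < size (s b).
Hypothesis phi_gt0 : forall b, 0 < size (phi b).

Lemma image_len_ge n w : size w <= len n w.
Proof.
by apply: leq_trans (size_iter_ext_ge n w s_gt0) (size_ext_ge _ phi_gt0).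
Qed.

Lemma image_len_ratio : exists2 K, 0 < K &
  forall n w, len n.+1 w <= K * len n w /\ len n w <= K * len n.+1 w.
Proof.
have bnd (C : Type) (f : A -> seq C) : exists k, forall b, size (f b) <= k.
  exists (\max_b size (f b)) => b.
  exact: (leq_bigmax b (F := fun b => size (f b))).
have [k hk] := bnd _ phi; have [l hl] := bnd _ s.
exists (k * l + k).+1 => // n w.
set v := iter n (ext s) w.
have h1 : len n w <= k * size v by exact: size_ext_le.
have h2 : size v <= len n w by exact: size_ext_ge.
have h3 : len n.+1 w <= k * size (ext s v) by exact: size_ext_le.
have h4 : size (ext s v) <= len n.+1 w by exact: size_ext_ge.
have h5 : size (ext s v) <= l * size v by exact: size_ext_le.
have h6 : size v <= size (ext s v) by exact: size_ext_ge.
split.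
  have h7 : k * size (ext s v) <= k * (l * size v) by rewrite leq_mul2l h5 orbT.
  have h8 : k * (l * size v) <= k * l * len n w by rewrite mulnA leq_mul2l h2 orbT.
  by rewrite mulSn mulnDl; lia.
have h7 : k * size v <= k * len n.+1 w by rewrite leq_mul2l (leq_trans h6 h4) orbT.
by rewrite mulSn mulnDl; lia.
Qed.

Lemma image_len_ratio_iter K j : 
  (forall n w, len n.+1 w <= K * len n w) ->
  forall n w, len (n + j) w <= K ^ j * len n w.
Proof.
move=> hK n w; elim: j => [|j IH]; first by rewrite addn0 mul1n.
rewrite addnS expnS -mulnA; apply: leq_trans (hK _ _) _.
by rewrite leq_mul2l IH orbT.
Qed.

Hypothesis idem : alphabet_idempotent s.

Lemma mem_subst_trans b c d : c \in s b -> d \in s c -> d \in s b.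
Proof. by move=> cb dc; rewrite -idem; apply/mem_ext; exists c. Qed.

(** Idempotence inserts a letter [e] between [d] and [c]. If [e] does not occur in its own image,
    its set of descendants is strictly smaller than that of [d], and the search continues from
    [e]. *)
Lemma mem_subst_loop d c :
  c \in s d -> exists e, [/\ e \in s d, e \in s e & c \in s e].
Proof.
have [k] := ubnP #|[set e in s d]|; elim: k d => // k IH d hk cd.
have : c \in ext s (s d) by rewrite idem.
case/mem_ext=> e ed ce; case: (boolP (e \in s e)) => ee; first by exists e.
have [|f [fe ff cf]] := IH e _ ce; last first.
  by exists f; split=> //; exact: mem_subst_trans fe.
rewrite -ltnS; apply: leq_trans hk; rewrite ltnS; apply: proper_card.
apply/properP; split; last by exists e; rewrite !inE.
by apply/subsetP=> f; rewrite !inE; exact: mem_subst_trans.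
Qed.

(* The letters whose iterated images stay bounded: the iterates of such a letter
   are stationary from the first one on. *)
Definition stationary (b : A) : bool := all (fun c => s c == [:: c]) (s b).

Lemma stationary_mem b c : stationary b -> c \in s b -> stationary c.
Proof.
move=> /allP h cb; have /eqP sc := h c cb.
by rewrite /stationary sc /= sc eqxx.
Qed.

Lemma stationary_ext w : all stationary w -> all stationary (ext s w).
Proof.
move=> /allP h; apply/allP=> c /mem_ext[b bw cb].
exact: stationary_mem (h b bw) cb.
Qed.

Lemma stationary_ext_idem w : all stationary w -> ext s (ext s w) = ext s w.
Proof.
elim: w => //= b w IH /andP[hb /IH {}IH]; rewrite ext_cons ext_cat IH.
congr (_ ++ _); move: hb; rewrite /stationary.
elim: (s b) => //= c v IHv /andP[/eqP sc /IHv {}IHv].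
by rewrite ext_cons sc IHv.
Qed.

Lemma nonstationary_mem b : ~~ stationary b ->
  exists e, [/\ e \in s b, e \in s e, 1 < size (s e) & ~~ stationary e].
Proof.
case/allPn=> c cb sc; have [e [eb ee ce]] := mem_subst_loop cb.
have se : s e != [:: e].
  apply/eqP=> se; move: ce; rewrite se inE => /eqP ec.
  by move: sc; rewrite ec se eqxx.
exists e; split=> //; last by apply/allPn; exists e.
case: (s e) se ee (s_gt0 e) => [|f [|g w]] //; rewrite inE => /eqP h /eqP ef.
by case: h; rewrite ef.
Qed.

(** Since [phi] is arbitrary, lengths may decrease at first. If [b] occurs in [s b], monotonicity is
    immediate. Otherwise each letter of [s b] has a smaller set formed by itself and its
    descendants, and one exponent is spent to pass to it; [#|A|] exponents suffice. *)
Lemma image_len_mono_letter b n : #|A| <= n ->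
  len n [:: b] <= len n.+1 [:: b] /\
  (~~ stationary b -> len n [:: b] < len n.+1 [:: b]).
Proof.
move=> hn.
have : #|b |: [set c in s b]| <= n by apply: leq_trans (max_card _) hn.
elim: n b {hn} => [|n IH] b hb.
  by rewrite leqn0 cards_eq0 -subset0 subUset sub1set inE in hb.
case: (boolP (b \in s b)) => bb.
  split; first by rewrite [leqRHS]image_lenS1 image_len_mem.
  move=> nb; rewrite [leqRHS]image_lenS1.
  have nsb : s b != [:: b].
    by apply: contra nb => /eqP sb; rewrite /stationary sb /= sb eqxx.
  case/splitPr: bb nsb => p q nsb; rewrite image_len_cat (image_len_cons _ b q).
  have := image_len_ge n.+1 p; have := image_len_ge n.+1 q.
  by case: p q nsb => [|? ?] [|? ?] //=; rewrite ?eqxx //; lia.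
have small c : c \in s b -> #|c |: [set d in s c]| <= n.
  move=> cb; rewrite -ltnS; apply: leq_trans hb; apply: proper_card.
  apply/properP; split.
    apply/subsetP=> d; rewrite !inE => /orP[/eqP ->|dc]; first by rewrite cb orbT.
    by rewrite (mem_subst_trans cb dc) orbT.
  exists b; rewrite !inE ?eqxx //; apply/norP; split.
    by apply: contra bb => /eqP e; rewrite {1}e.
  by apply: contra bb; exact: mem_subst_trans.
have mono : {in s b, forall c, len n [:: c] <= len n.+1 [:: c]}.
  by move=> c cb; have [] := IH c (small c cb).
rewrite !image_lenS1; split; first exact: image_len_le_words.
case/nonstationary_mem=> e [eb _ _ ne].
have [_ lte] := IH e (small e eb).
by apply: (image_len_lt_words mono eb); exact: lte.
Qed.

Lemma image_len_mono w n : #|A| <= n -> len n w <= len n.+1 w.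
Proof.
move=> hn; apply: image_len_le_words => b _.
by have [] := image_len_mono_letter b hn.
Qed.

Lemma image_len_strict w n :
  #|A| <= n -> ~~ all stationary w -> len n w < len n.+1 w.
Proof.
move=> hn /allPn[d dw nd]; apply: (image_len_lt_words (d := d)) => //.
  by move=> b _; have [] := image_len_mono_letter b hn.
by have [_ ->] := image_len_mono_letter d hn.
Qed.

End ImageLength.

(** * Factors and recurrence *)

Lemma fin_eventually (T : finType) (P : T -> nat -> Prop) :
  (forall t, exists n, forall m, n <= m -> P t m) ->
  exists n, forall t m, n <= m -> P t m.
Proof.
move=> /fin_all_exists[f hf]; exists (\max_t f t) => t m hm.
by apply: hf; apply: leq_trans hm; exact: leq_bigmax.
Qed.

Definition infinite (I : nat -> Prop) : Prop := forall N, exists2 n, N <= n & I n.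

Lemma not_infinite (I : nat -> Prop) :
  ~ infinite I -> exists N, forall n, N <= n -> ~ I n.
Proof.
move=> h; apply: NNPP => h'; apply: h => N; apply: NNPP => hN.
by apply: h'; exists N => n Nn In; apply: hN; exists n.
Qed.

Lemma infinite_pigeonhole (T : finType) (f : nat -> T) (I : nat -> Prop) :
  infinite I -> exists t, infinite (fun n => I n /\ f n = t).
Proof.
move=> Iinf; apply: NNPP => h.
have /fin_eventually[N hN] : forall t, exists n, forall m, n <= m -> ~ (I m /\ f m = t).
  by move=> t; apply: not_infinite => ht; apply: h; exists t.
by have [n Nn In] := Iinf N; apply: (hN (f n) n Nn).
Qed.

Lemma count_spaced (c : pred nat) g P W :
  (forall i p, 0 < p -> c i -> c (i + p) -> g <= p) ->
  count c (iota P W) * g <= W + g.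
Proof.
move=> sp; have [k] := ubnP W; elim: k P W => // k IH P [|W] hW //=.
case: (boolP (c P)) => cP; last first.
  by apply: leq_trans (IH _ _ _) _; lia.
case: (leqP g W.+1) => gW; last first.
  rewrite (_ : count c _ = 0); first by lia.
  apply/eqP; rewrite -leqn0 leqNgt -has_count; apply/hasPn=> j.
  rewrite mem_iota => hj; apply/negP=> cj.
  by have := sp P (j - P); rewrite subnKC; [move/(_ _ cP cj); lia | lia].
case: g sp IH gW => [|g] sp IH gW; first by rewrite muln0.
have -> : W = g + (W - g) by lia.
rewrite iotaD count_cat (_ : count c (iota P.+1 g) = 0).
  have := IH (P.+1 + g) (W - g); rewrite add0n; lia.
apply/eqP; rewrite -leqn0 leqNgt -has_count; apply/hasPn=> j.
rewrite mem_iota => hj; apply/negP=> cj.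
by have := sp P (j - P); rewrite subnKC; [move/(_ _ cP cj); lia | lia].
Qed.

Definition slice (B : Type) (x : nat -> B) i n := mkseq (fun k => x (i + k)) n.

Section Slices.

Variables (B : finType) (x : nat -> B).
Local Notation sl := (slice x).

Lemma size_slice i n : size (sl i n) = n.
Proof. exact: size_mkseq. Qed.

Lemma slice0 n : sl 0 n = mkseq x n.
Proof. by []. Qed.

Lemma sliceD i m n : sl i (m + n) = sl i m ++ sl (i + m) n.
Proof.
rewrite /slice /mkseq iotaD map_cat add0n; congr (_ ++ _).
rewrite -[in LHS](addn0 m) iotaDl -map_comp; apply: eq_map => k /=.
by rewrite addnA.
Qed.

Lemma eq_sliceP i j n : 
  (forall d, d < n -> x (i + d) = x (j + d)) <-> sl i n = sl j n.
Proof.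
split=> [h|h d dn].
  by apply/eq_in_map => d; rewrite mem_iota => /andP[_ dn]; exact: h.
have := congr1 (fun w => nth (x 0) w d) h.
by rewrite !nth_mkseq.
Qed.

Lemma eq_slice_sub i j n d m :
  sl i n = sl j n -> d + m <= n -> sl (i + d) m = sl (j + d) m.
Proof.
move=> /eq_sliceP h dm; apply/eq_sliceP => k km.
by rewrite -!addnA; apply: h; lia.
Qed.

Lemma slice_infix i j m n :
  i <= j -> j + m <= i + n -> infix (sl j m) (sl i n).
Proof.
move=> ij jm; have -> : n = (j - i) + (m + (i + n - (j + m))) by lia.
by rewrite !sliceD subnKC // infix_infix.
Qed.

Lemma infix_slice w i n : infix w (sl i n) ->
  exists j, [/\ i <= j, j + size w <= i + n & occurs_at w x j].
Proof.
case/infixP=> p [q e]; have := congr1 size e.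
rewrite size_slice !size_cat => en; exists (i + size p); split; [lia|lia|].
move: e; rewrite en !sliceD => /eqP; rewrite eqseq_cat ?size_slice //.
by case/andP=> _; rewrite eqseq_cat ?size_slice // => /andP[/eqP].
Qed.

Lemma occurs_slice i n : occurs_at (sl i n) x i.
Proof. by rewrite /occurs_at size_slice. Qed.

Lemma factor_slice i n : factor (sl i n) x.
Proof. by exists i; exact: occurs_slice. Qed.

Lemma factor_infix v w : factor w x -> infix v w -> factor v x.
Proof.
by case=> i <- /infix_slice[j [_ _ h]]; exists j.
Qed.

Lemma factor_prefix w : prefix_of w x -> factor w x.
Proof. by exists 0. Qed.

Definition occ (w : seq B) : pred nat := fun i => sl i (size w) == w.

Lemma occP w i : reflect (occurs_at w x i) (occ w i).
Proof. exact: eqP. Qed.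

Lemma occ_window w i j n :
  sl i n = sl j n -> size w <= n -> occ w i = occ w j.
Proof.
move=> h wn; have := eq_slice_sub (d := 0) (m := size w) h.
by rewrite !addn0 add0n /occ => ->.
Qed.

Definition occurs_syndetically w R :=
  forall i, exists2 j, occ w j & i <= j < i + R.

Lemma uniformly_recurrent_window w :
  uniformly_recurrent x -> factor w x -> exists R, occurs_syndetically w R.
Proof.
move=> ur fw; have [inf [g gap]] := ur w fw; have [i0 /occP o0] := fw.
(* A window starting at or before the known occurrence [i0] reaches it; a later one lies to the
   right of some occurrence, and the gap bound applies to the last one before [i] and the first one
   from [i] on. *)
exists (i0 + g).+1 => i.
have ex : exists j, (i <= j) && occ w j.
  by have [j ij /occP oj] := inf i; exists j; rewrite ij.
case: (ex_minnP ex) => j /andP[ij oj] jmin.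
exists j => //; rewrite ij /=; case: (leqP i i0) => hi.
  by have := jmin i0; rewrite hi o0 => /(_ isT); lia.
have ex' : exists k, (k < i) && occ w k by exists i0; rewrite hi.
have ub k : (k < i) && occ w k -> k <= i by case/andP=> /ltnW.
case: (ex_maxnP ex' ub) => k /andP[ki ok] kmax.
have kj : k < j by lia.
have /(_ _)/wrap[] := gap k j kj (elimT (occP _ _) ok) (elimT (occP _ _) oj).
  move=> l /andP[kl lj] /occP ol; case: (leqP i l) => il.
    by have := jmin l; rewrite il ol => /(_ isT); lia.
  by have := kmax l; rewrite il ol => /(_ isT); lia.
by lia.
Qed.

Lemma uniformly_recurrent_infix w :
  uniformly_recurrent x -> factor w x ->
  exists R, forall v, factor v x -> R <= size v -> infix w v.
Proof.
move=> ur fw; have [R hR] := uniformly_recurrent_window ur fw.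
exists (R + size w) => v [i <-]; rewrite size_mkseq => hv.
have [j /eqP oj /andP[ij jR]] := hR i.
by rewrite -[X in infix X _]oj; apply: slice_infix => //; lia.
Qed.

Definition purely_periodic := exists2 p, 0 < p & forall i, x (i + p) = x i.

Lemma nth_power_period (v : seq B) m k b : k < m * size v ->
  nth b (flatten (nseq m.+1 v)) (k + size v) = nth b (flatten (nseq m.+1 v)) k.
Proof.
move=> km; have e : flatten (nseq m.+1 v) = flatten (nseq m v) ++ v.
  by rewrite -addn1 nseqD flatten_cat /= cats0.
have sz : size (flatten (nseq m v)) = m * size v.
  elim: (m) => //= n IH; by rewrite size_cat IH mulSn.
rewrite [in RHS]e /= !nth_cat sz km ltnNge leq_addl /=.
by rewrite addnK.
Qed.

(** A long enough power contains the prefix of [x] up to [i + size v], which therefore has period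
    [size v]. *)
Lemma powers_purely_periodic (v : seq B) :
  uniformly_recurrent x -> 0 < size v ->
  (forall m, factor (flatten (nseq m v)) x) -> purely_periodic.
Proof.
move=> ur v0 pow; exists (size v) => // i.
have [R hR] := uniformly_recurrent_infix ur (factor_slice 0 (i + size v).+1).
have sz m : size (flatten (nseq m v)) = m * size v.
  elim: m => //= n IH; by rewrite size_cat IH mulSn.
have /infixP[p [q e]] := hR _ (pow R.+1) ltac:(rewrite sz; nia).
have szE : R.+1 * size v = size p + ((i + size v).+1 + size q).
  by rewrite -sz e !size_cat size_slice.
have h k : k <= i + size v -> nth (x 0) (flatten (nseq R.+1 v)) (size p + k) = x k.
  move=> hk; rewrite e nth_cat ifN; last by rewrite -leqNgt leq_addr.
  by rewrite addKn nth_cat size_slice ltnS hk nth_mkseq.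
rewrite -h // -[RHS]h ?leq_addr // addnA; apply: nth_power_period.
by rewrite mulSn in szE; lia.
Qed.

Lemma purely_periodic_primitive_substitutive :
  purely_periodic -> primitive_substitutive x.
Proof.
case=> p p0 per.
(* A one-letter alphabet, spelled by the period. The exponent [p + 1] keeps the image of length at
   least two when [p = 1]. *)
apply: (@decorated_primitive_substitutive B unit tt
  (fun _ => nseq p.+1 tt) (fun _ => mkseq x p) _ _ _ _ x (nseq p tt)) => //.
- by move=> _; rewrite size_mkseq.
- by move=> _; rewrite size_mkseq size_nseq leqnSn.
- by move=> _; rewrite size_nseq.
move=> n; elim: (iter_word _ _ _) => // -[] w IH.
rewrite /prefix_of ext_cons size_cat size_mkseq -slice0 sliceD.
congr (_ ++ _); rewrite -[RHS]IH; apply: eq_map => i.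
by rewrite addnC add0n per.
Qed.

Definition linearly_recurrent K := forall l i j, 0 < l ->
  exists k, [/\ i <= k, k + l <= i + K * l & sl k l = sl j l].

(* A repetition with a period short compared with its length would contain all
   words of length [p + 1] and force [p] to be a period of [x]. *)
Lemma occ_gap K U i p :
  linearly_recurrent K -> ~ purely_periodic -> 0 < p ->
  occ U i -> occ U (i + p) -> size U < K * p.+1.
Proof.
move=> lr aper p0 /eqP Ui /eqP Uip; rewrite ltnNge; apply/negP=> hU.
apply: aper; exists p => // j.
have [k [ik kl /eq_sliceP e]] := lr p.+1 i j isT.
have e0 := e 0 isT; have ep := e p (ltnSn p); rewrite !addn0 in e0.
rewrite -ep -e0; have /eq_sliceP h : sl i (size U) = sl (i + p) (size U) by rewrite Ui.
have := h (k - i); rewrite addnAC subnKC // => -> //; lia.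
Qed.

Lemma occ_count K U g P W :
  linearly_recurrent K -> ~ purely_periodic -> K * g <= size U ->
  count (occ U) (iota P W) * g <= W + g.
Proof.
move=> lr aper hU; apply: count_spaced => i p p0 o1 o2.
rewrite leqNgt; apply/negP=> pg.
have := occ_gap lr aper p0 o1 o2; rewrite ltnNge; apply/negP; rewrite negbK.
by apply: leq_trans hU; rewrite leq_mul2l pg orbT.
Qed.

End Slices.

(** * Runs over an invariant subalphabet *)

Lemma cat_eq_cat (T : Type) (p q p' q' : seq T) : p ++ q = p' ++ q' ->
  (exists2 z, p' = p ++ z & q = z ++ q') \/
  (exists c z, p = p' ++ c :: z /\ q' = c :: z ++ q).
Proof.
elim: p p' => [|b p IH] [|b' p'] /=.
- by move=> ->; left; exists [::].
- by move=> ->; left; exists (b' :: p').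
- by move=> <-; right; exists b, p.
case=> -> /IH[[z -> ->]|[c [z [-> ->]]]]; first by left; exists z.
by right; exists c, z.
Qed.

Section Runs.

Variables (A : finType) (s : A -> seq A) (S : pred A).
Hypothesis S_closed : forall b, S b -> all S (s b).
Hypothesis S_compl : forall b, ~~ S b -> ~~ all S (s b).

Lemma run_split_unique (p p' w w' : seq A) f f' :
  all S p -> all S p' -> ~~ S f -> ~~ S f' ->
  p ++ f :: w = p' ++ f' :: w' -> [/\ p = p', f = f' & w = w'].
Proof.
move=> + + nf nf'; elim: p p' => [|b p IH] [|b' p'] //=.
- by move=> _ _ [-> ->].
- by move=> _ /andP[Sb _] [e _]; rewrite e Sb in nf.
- by move=> /andP[Sb _] _ [e _]; rewrite -e Sb in nf'.
by move=> /andP[_ Sp] /andP[_ Sp'] [-> /(IH _ Sp Sp')[-> -> ->]].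
Qed.

Let cut (w : seq A) : nat := find (predC S) w.

Definition run_head b := nth b (s b) (cut (s b)).
Definition run_prefix b := take (cut (s b)) (s b).
Definition run_last b := nth b (rev (s b)) (cut (rev (s b))).
Definition run_suffix b := rev (take (cut (rev (s b))) (rev (s b))).

Let cut_split w b : ~~ all S w ->
  [/\ all S (take (cut w) w), ~~ S (nth b w (cut w)) &
      w = take (cut w) w ++ nth b w (cut w) :: drop (cut w).+1 w].
Proof.
rewrite -has_predC => h; split; last 2 first.
- exact: (nth_find b h).
- by rewrite -drop_nth -?has_find // cat_take_drop.
apply/(all_nthP b) => i; rewrite size_take -has_find h => ic.
by rewrite nth_take //; have := before_find b ic; rewrite /= => /negbFE.
Qed.

Lemma run_prefixP b : ~~ S b ->
  [/\ all S (run_prefix b), ~~ S (run_head b) &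
      exists w, s b = run_prefix b ++ run_head b :: w].
Proof.
by move=> /S_compl/(cut_split b)[h1 h2 h3]; split=> //; eexists; exact: h3.
Qed.

Lemma run_suffixP b : ~~ S b ->
  [/\ all S (run_suffix b), ~~ S (run_last b) &
      exists w, s b = w ++ run_last b :: run_suffix b].
Proof.
move=> /S_compl; rewrite -all_rev => /(cut_split b)[h1 h2 h3].
split=> //; first by rewrite all_rev.
exists (rev (drop (cut (rev (s b))).+1 (rev (s b)))).
by rewrite -[LHS]revK {1}h3 rev_cat rev_cons cat_rcons.
Qed.

Lemma run_suffix_unique b p f w : all S p -> ~~ S f -> s b = w ++ f :: p ->
  p = run_suffix b /\ f = run_last b.
Proof.
move=> Sp nf e; have nb : ~~ S b.
  apply/negP=> /S_closed; rewrite e all_cat /= => /and3P[_ h _].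
  by rewrite h in nf.
have [Sq ng [v e']] := run_suffixP nb.
have : rev p ++ f :: rev w = rev (run_suffix b) ++ run_last b :: rev v.
  by move: e; rewrite e' => /(congr1 rev); rewrite !rev_cat !rev_cons !cat_rcons.
have Sp' : all S (rev p) by rewrite all_rev.
have Sq' : all S (rev (run_suffix b)) by rewrite all_rev.
by case/(run_split_unique Sp' Sq' nf ng) => /(can_inj revK) -> ->.
Qed.

(** A triple [(e, r, b)] is a maximal block [r] over [S] together with its two neighbours outside
    [S], which determine how it grows under [s]. *)
Definition run (t : A * seq A * A) (w : seq A) : Prop :=
  [/\ ~~ S t.1.1, ~~ S t.2, all S t.1.2 & infix (t.1.1 :: t.1.2 ++ [:: t.2]) w].

Definition run_step (t : A * seq A * A) : A * seq A * A :=
  (run_last t.1.1,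
   run_suffix t.1.1 ++ ext s t.1.2 ++ run_prefix t.2,
   run_head t.2).

Let S_ext w : all S w -> all S (ext s w).
Proof.
move=> /allP h; apply/allP => c /mem_ext[b bw cb].
by apply: (allP (S_closed (h b bw))).
Qed.

Lemma run_stepP t w : run t w -> run (run_step t) (ext s w).
Proof.
case: t => -[e r] b [/= ne nb Sr /infixP[p [q ->]]].
have [Sq ng [v e1]] := run_suffixP ne; have [Sp nf [v' e2]] := run_prefixP nb.
split=> //=; first by rewrite !all_cat Sq Sp S_ext.
apply/infixP; exists (ext s p ++ v), (v' ++ ext s q).
rewrite !(ext_cat, ext_cons) e1 e2 /= cats0.
by do ![rewrite -?catA /=].
Qed.

Lemma run_prefix_desubst w r b v : all S r -> ~~ S b -> ext s w = r ++ b :: v ->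
  exists r' b' w', [/\ w = r' ++ b' :: w', all S r', ~~ S b', b = run_head b' &
                       r = ext s r' ++ run_prefix b'].
Proof.
move=> + nb; elim: w r => [|c w IH] r Sr; first by case: r {Sr}.
rewrite ext_cons; case Sc: (S c).
  case/cat_eq_cat => [[z zr e]|[d [z [e]]]].
    move: Sr; rewrite zr all_cat => /andP[_ Sz].
    have [r' [b' [w' [-> Sr' nb' -> ->]]]] := IH z Sz e.
    by exists (c :: r'), b', w'; rewrite /= Sc Sr' ext_cons catA.
  case=> bd _; move: (S_closed Sc); rewrite e all_cat /= -bd.
  by rewrite (negbTE nb) andbF.
have [Sp nf [v' e]] := run_prefixP (negbT Sc).
rewrite e -catA /= => /(run_split_unique Sp Sr nf nb)[<- <- _].
by exists [::], c, w; rewrite Sc.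
Qed.

(** If the end letters of the run come from different letters of [w], those two letters are outside
    [S] by [S_closed], and the letters between them are in [S], since by [S_compl] the image of any
    other would interrupt the run. *)
Lemma run_desubst t w : run t (ext s w) ->
  (exists2 c, c \in w & run t (s c)) \/ (exists2 t', run t' w & t = run_step t').
Proof.
case: t => -[e r] b [/= ne nb Sr /infixP[p [q]]].
rewrite [(_ :: _) ++ q]/= -catA /=.
elim: w p => [|c w IH] p; first by case: p.
rewrite ext_cons => /cat_eq_cat[[z _ /IH]|[d [z [e1 [ed e2]]]]].
  case=> [[d dw rd]|[t' [n1 n2 St it]]]; first by left; exists d; rewrite ?inE ?dw ?orbT.
  by right; exists t' => //; split=> //; rewrite infix_consl it orbT.
rewrite -ed in e1.
move/esym/cat_eq_cat: e2 => [[y yr e2]|[d' [y [e2 [bd' _]]]]]; last first.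
  left; exists c; first exact: mem_head.
  split=> //=; apply/infixP; exists p, y.
  by rewrite e1 e2 bd' /= -catA.
move: Sr; rewrite yr all_cat => /andP[Sz Sy].
have [zE eE] := run_suffix_unique Sz ne e1.
have [r' [b' [w' [-> Sr' nb' bE ->]]]] := run_prefix_desubst Sy nb e2.
right; exists (c, r', b'); last by rewrite /run_step /= eE zE bE.
split=> //=.
  by apply/negP=> /S_closed; rewrite e1 all_cat /= (negbTE ne) andbF.
by apply/orP; left; rewrite eqxx; apply/prefixP; exists w'; rewrite -catA.
Qed.

Variables (a : A) (u : seq A).
Hypothesis s_start : s a = a :: u.
Hypothesis a_nS : ~~ S a.
Hypothesis u_nS : ~~ all S u.

Let iter_nS n w : ~~ all S w -> ~~ all S (iter n (ext s) w).
Proof.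
move=> h; elim: n => // n /allPn[b bw nb] /=.
case/S_compl/allPn: nb => c cb nc; apply/allPn; exists c => //.
by apply/mem_ext; exists b.
Qed.

(** On the left, the initial letter [a] is outside [S] and bounds the run. On the right [s^n a] may
    end inside the run, which is then closed in [s^(n+1) a = s^n a s^n u] by a letter of [s^n u]. *)
Lemma run_of_word n w : w != [::] -> all S w -> infix w (iter_word s n a) ->
  exists2 t, run t (iter_word s n.+1 a) & size w <= size t.1.2.
Proof.
move=> w0 Sw /infixP[p [q e]].
have /prefixP[v av] : prefix [:: a] (iter_word s n a).
  exact: (prefix_iter_word s_start (leq0n n)).
have np : ~~ all S p.
  move: e; rewrite av; case: p => [|b p] /=.
    by case: w w0 Sw => //= b w _ /andP[Sb _] [ab _]; move: a_nS; rewrite ab Sb.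
  by case=> <- _; rewrite (negbTE a_nS).
pose q' := q ++ iter n (ext s) u.
have nq : ~~ all S q' by rewrite all_cat (negbTE (iter_nS n u_nS)) andbF.
have eS : iter_word s n.+1 a = p ++ w ++ q'.
  by rewrite iter_wordS s_start -cat1s iter_ext_cat -/(iter_word s n a) e /q' -!catA.
have [Sq1 nb eq1] := cut_split a nq.
have [] := cut_split a (w := rev p); first by rewrite all_rev.
move=> Sp1 ne ep1.
exists (nth a (rev p) (cut (rev p)),
        rev (take (cut (rev p)) (rev p)) ++ w ++ take (cut q') q',
        nth a q' (cut q')).
  split; [exact: ne | exact: nb | by rewrite /= !all_cat Sw Sq1 all_rev Sp1 |].
  apply/infixP; exists (rev (drop (cut (rev p)).+1 (rev p))), (drop (cut q').+1 q').
  rewrite eS -[p in LHS]revK {1}ep1 {1}eq1 rev_cat rev_cons.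
  by rewrite cat_rcons; do ![rewrite -?catA /=].
by rewrite /= !size_cat; lia.
Qed.

Definition run_origin t := exists n c, c \in iter_word s n a /\ run t (s c).

Lemma run_origin_exists n t : run t (iter_word s n a) ->
  exists t0 k, run_origin t0 /\ t = iter k run_step t0.
Proof.
elim: n t => [|n IH] t; first by case=> _ _ _ /size_infix; rewrite /= size_cat addn1.
rewrite /iter_word iterS => /run_desubst[[c cw rc]|[t' /IH[t0 [k [ot ->]]] ->]].
  by exists t, 0; split=> //; exists n, c.
by exists t0, k.+1.
Qed.

(* Every run descends from one of the finitely many runs inside a word [s c]. *)
Lemma runs_dichotomy :
  (exists L, forall n w, all S w -> infix w (iter_word s n a) -> size w <= L) \/
  (exists t0 n0,
     (forall k, run (iter k run_step t0) (iter_word s (n0 + k) a)) /\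
     (forall L, exists k, L < size (iter k run_step t0).1.2)).
Proof.
apply: NNPP => /not_or_and[nL nC].
pose M := \max_c size (s c).
(* The middle word of an origin lies inside some [s c], so its length is at most [M] and [T]
   contains all candidates. *)
pose T : finType := (A * M.-bseq A * A)%type.
pose tr (t : T) : A * seq A * A := (t.1.1, t.1.2 : seq A, t.2).
have /fin_eventually[L hL] : forall t : T, exists n, forall m, n <= m ->
    run_origin (tr t) -> forall k, size (iter k run_step (tr t)).1.2 <= m.
  move=> t; apply: NNPP => h; apply: nC.
  have ot : run_origin (tr t).
    by apply: NNPP => no; apply: h; exists 0.
  have [n [c [cn rt]]] := ot; exists (tr t), n.+1; split.
    elim=> [|k IH]; last by rewrite addnS /iter_word iterS; exact: run_stepP.
    rewrite addn0; case: rt => h1 h2 h3 h4; split=> //.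
    by apply: infix_trans h4 _; rewrite /iter_word iterS; exact: infix_mem_ext.
  move=> L; apply: NNPP => hL; apply: h; exists L => m Lm _ k.
  by rewrite leqNgt; apply/negP=> mk; apply: hL; exists k; exact: leq_ltn_trans mk.
apply: nL; exists L => n w Sw /run_of_word.
case: (eqVneq w [::]) => [-> _ //|w0 /(_ isT Sw)[t rt wt]].
apply: leq_trans wt _.
have [[[e r] b] [k [ot tE]]] := run_origin_exists rt.
have rM : size r <= M.
  have [m [c [_ [_ _ _ /size_infix]]]] := ot; rewrite /= size_cat => h.
  have : size (s c) <= M by exact: (leq_bigmax c (F := fun c => size (s c))).
  by lia.
by rewrite tE; exact: (hL (e, Bseq rM, b) L (leqnn L) ot k).
Qed.

End Runs.

(** * Stationary letters *)

Lemma ext_flatten_nseq (A B : Type) (f : A -> seq B) m v :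
  ext f (flatten (nseq m v)) = flatten (nseq m (ext f v)).
Proof. by elim: m => //= m IH; rewrite ext_cat IH. Qed.

Section StationaryRuns.

Variables (A B : finType) (s : A -> seq A) (phi : A -> seq B) (a : A) (u : seq A).
Variable x : nat -> B.
Hypothesis nf : normal_form s phi a u x.
Hypothesis ur : uniformly_recurrent x.
Hypothesis aper : ~ purely_periodic x.

Local Notation stat := (stationary s).
Local Notation len := (image_len s phi).

Let s_gt0 := nf_gt0 nf.
Let phi_gt0 := nf_phi_gt0 nf.
Let sa := nf_start nf.
Let idem := nf_idem nf.

Lemma factor_image w n m :
  infix w (iter_word s n a) -> factor (ext phi (iter m (ext s) w)) x.
Proof.
move=> h; apply: factor_infix (factor_prefix (nf_prefix nf (m + n))) _.
by apply: infix_ext; rewrite /iter_word iterD; exact: infix_iter_ext.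
Qed.

Lemma factor_image0 w n : infix w (iter_word s n a) -> factor (ext phi w) x.
Proof. exact: (@factor_image w n 0). Qed.

Lemma no_powers v : 0 < size v ->
  ~ (forall m, exists n, infix (flatten (nseq m v)) (iter_word s n a)).
Proof.
move=> v0 h; apply: aper; apply: (@powers_purely_periodic _ _ (ext phi v)) => //.
  exact: leq_trans v0 (size_ext_ge _ phi_gt0).
by move=> m; have [n /factor_image0] := h m; rewrite ext_flatten_nseq.
Qed.

Lemma start_nonstationary : ~~ stat a.
Proof.
apply/negP=> /allP/(_ a); rewrite sa mem_head => /(_ isT)/eqP[].
by move: (nf_u_gt0 nf); case: u.
Qed.

Let stat_closed b : stat b -> all stat (s b).
Proof. by move=> h; apply/allP=> c; exact: stationary_mem. Qed.

Let stat_compl b : ~~ stat b -> ~~ all stat (s b).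
Proof.
move=> /(nonstationary_mem s_gt0 idem)[e [eb _ _ ne]].
by apply/allPn; exists e.
Qed.

(** Otherwise [s^(m+1) a] would end with [m] copies of [s u]. *)
Lemma u_nonstationary : ~~ all stat u.
Proof.
apply/negP=> Su; apply: (@no_powers (ext s u)).
  exact: leq_trans (nf_u_gt0 nf) (size_ext_ge _ s_gt0).
have iu m : iter m.+1 (ext s) u = ext s u.
  by elim: m => // m IH; rewrite iterS IH stationary_ext_idem.
move=> m; exists m.+1; apply: suffixW; elim: m => [|m IH]; first exact: suffix0s.
case/suffixP: IH => w hw; rewrite iter_wordS sa -cat1s iter_ext_cat.
rewrite -/(iter_word s m.+1 a) hw iu -addn1 nseqD flatten_cat /= cats0 -catA.
exact: suffix_suffix.
Qed.

Let step := run_step s stat.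

(* On stationary words [s] is idempotent, so [s] applied to a run only gains,
   at each step, a left and a right factor determined by the end letters. *)
Let step_context d e b : ~~ stat e -> ~~ stat b ->
  exists V V', forall r, all stat r ->
    ext s (iter d step (e, r, b)).1.2 = V ++ ext s r ++ V'.
Proof.
elim: d e b => [|d IH] e b ne nb; first by exists [::], [::] => r _; rewrite cats0.
have [Sq nl _] := run_suffixP stat_compl ne.
have [Sp nh _] := run_prefixP stat_compl nb.
have [V [V' h]] := IH _ _ nl nh.
exists (V ++ ext s (run_suffix s stat e)), (ext s (run_prefix s stat b) ++ V') => r Sr.
rewrite iterSr h /= ?all_cat ?Sq ?Sp ?stationary_ext //.
by rewrite !ext_cat stationary_ext_idem // -!catA.
Qed.

(** Along an unbounded chain of runs the pair of end letters becomes periodic. Each period then adds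
    the same [V] on the left and [V'] on the right of the image of the middle word. If one of them
    is nonempty, its powers occur, against [no_powers]; if both are empty, the chain is bounded. *)
Lemma stationary_runs_bounded :
  exists L, forall n w, all stat w -> infix w (iter_word s n a) -> size w <= L.
Proof.
have [//|[t0 [n0 [hrun hunb]]]] := runs_dichotomy stat_closed stat_compl sa
  start_nonstationary u_nonstationary.
exfalso; pose t k := iter k step t0.
pose h (z : A * A) := (run_last s stat z.1, run_head s stat z.2).
have st k : ((t k).1.1, (t k).2) = iter k h (t0.1.1, t0.2).
  by elim: k => //= k <-.
have [p p0 pp] := iter_idempotent_power h (t0.1.1, t0.2).
case E: (t p) => [[e r] b].
have stE m : exists r', t (p + m * p) = (e, r', b).
  elim: m => [|m [r' IH]]; first by exists r; rewrite addn0.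
  have key : iter (p + m.+1 * p) h (t0.1.1, t0.2) = iter (p + m * p) h (t0.1.1, t0.2).
    have -> : p + m.+1 * p = m * p + (p + p) by rewrite mulSn; lia.
    by rewrite iterD pp -iterD addnC.
  have := st (p + m.+1 * p); rewrite key -st IH /=.
  by case: (t _) => -[e' r''] b' /= [-> ->]; exists r''.
have [/= ne nb Sr _] : run stat (t p) (iter_word s (n0 + p) a) by exact: hrun.
rewrite E in ne nb Sr.
have [V [V' hV]] := step_context p ne nb.
have hL m : ext s (t (p + m * p)).1.2 =
    flatten (nseq m V) ++ ext s r ++ flatten (nseq m V').
  elim: m => [|m IH]; first by rewrite addn0 E /= cats0.
  have [r' er'] := stE m.
  have [_ _ /= Sr' _] : run stat (t (p + m * p)) (iter_word s (n0 + (p + m * p)) a).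
    exact: hrun.
  rewrite er' in Sr' IH.
  have -> : p + m.+1 * p = p + (p + m * p) by rewrite mulSn; lia.
  rewrite {1}/t iterD -/(t (p + m * p)) er' hV // IH.
  have fl W : flatten (nseq m W) ++ W = W ++ flatten (nseq m W).
    by rewrite -[RHS]/(flatten (nseq m.+1 W)) -addn1 nseqD flatten_cat /= cats0.
  by rewrite /= -!catA fl.
have hin m : infix (ext s (t (p + m * p)).1.2) (iter_word s (n0 + (p + m * p)).+1 a).
  have [_ _ _ h1] : run stat (t (p + m * p)) (iter_word s (n0 + (p + m * p)) a).
    exact: hrun.
  rewrite /iter_word iterS; apply: infix_ext.
  by move/consl_infix/catr_infix: h1.
case: (posnP (size V)) => V0; last first.
  apply: (no_powers V0) => m; eexists; apply: infix_trans (hin m).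
  by rewrite hL prefix_infix.
case: (posnP (size V')) => V'0; last first.
  apply: (no_powers V'0) => m; eexists; apply: infix_trans (hin m).
  by rewrite hL catA suffix_infix.
have nil m : flatten (nseq m ([::] : seq A)) = [::] by elim: m.
have mono k j : size (t k).1.2 <= size (t (k + j)).1.2.
  elim: j => [|j IH]; rewrite ?addn0 // addnS; apply: leq_trans IH _.
  rewrite /t /= !size_cat.
  by have := size_ext_ge (iter (k + j) step t0).1.2 s_gt0; lia.
have [k] := hunb (size (ext s r)); rewrite -/(t k) ltnNge => /negP; apply.
apply: leq_trans (_ : size (t (p + k * p)).1.2 <= _).
  have -> : p + k * p = k + (p + k * p - k) by nia.
  exact: mono.
apply: leq_trans (size_ext_ge _ s_gt0) _.
by rewrite hL (size0nil V0) (size0nil V'0) nil cats0.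
Qed.

Lemma loop_growth e n : e \in s e -> 1 < size (s e) -> n < size (iter_word s n e).
Proof.
move=> ee; have [p [q E]] : exists p q : seq A, s e = p ++ e :: q.
  by case/splitPr: ee => p q; exists p, q.
rewrite E size_cat /= => se; elim: n => // n IH.
rewrite iter_wordS E -cat1s !iter_ext_cat !size_cat -/(iter_word s n e).
by have := size_iter_ext_ge n p s_gt0; have := size_iter_ext_ge n q s_gt0; lia.
Qed.

Lemma nonstationary_growth c n : ~~ stat c -> n <= len n [:: c].
Proof.
case/(nonstationary_mem s_gt0 idem)=> e [ec ee se _]; case: n => // n.
rewrite image_lenS1; apply: leq_trans (image_len_mem _ _ _ ec).
by apply: leq_trans (loop_growth n ee se) (size_ext_ge _ phi_gt0).
Qed.

(* A nonstationary letter whose set of descendants is minimal generates a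
   primitive piece of [s], up to stationary letters. *)
Lemma minimal_letter : exists c0,
  [/\ c0 \in s a, c0 \in s c0, ~~ stat c0 &
      forall d, d \in s c0 -> ~~ stat d -> s d =i s c0].
Proof.
have [e0 [e0a _ _ ne0]] := nonstationary_mem s_gt0 idem start_nonstationary.
have P0 : (e0 \in s a) && ~~ stat e0 by rewrite e0a.
case: (@arg_minnP _ e0 (fun b => (b \in s a) && ~~ stat b)
  (fun b => #|[set c in s b]|) P0) => b /andP[ba nb] bmin.
(* The minimal [b] need not occur in its own image; [e] does, and it inherits minimality. *)
have [e [eb ee _ ne]] := nonstationary_mem s_gt0 idem nb.
exists e; split=> //; first exact: mem_subst_trans ba eb.
move=> d de nd.
have db : d \in s b by exact: mem_subst_trans eb de.
have hs : [set c in s d] \subset [set c in s e].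
  by apply/subsetP=> c; rewrite !inE; exact: mem_subst_trans.
have hs' : [set c in s e] \subset [set c in s b].
  by apply/subsetP=> c; rewrite !inE; exact: mem_subst_trans.
have : [set c in s d] == [set c in s e].
  rewrite eqEcard hs; apply: leq_trans (subset_leq_card hs') _.
  by apply: bmin; rewrite nd (mem_subst_trans idem ba db).
by move=> /eqP/setP h c; have := h c; rewrite !inE.
Qed.

End StationaryRuns.

(** Letters are trimmed from both ends of [v] as long as [w] still fits. When this stops with at
    least two letters left, [w] overlaps both end images and so contains the image of the
    interior. *)
Lemma infix_ext_cover (A B : eqType) (f : A -> seq B) v w :
  infix w (ext f v) -> exists v',
  [/\ infix v' v, infix w (ext f v') &
    size v' <= 1 \/ exists c r d, [/\ v' = c :: rcons r d,
      infix (ext f r) w & size (ext f r) < size w]].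
Proof.
have [k] := ubnP (size v); elim: k v => // k IH v hk h.
have [v1|v1] := leqP (size v) 1.
  by exists v; split=> //; [exact: infix_refl | left].
case: v v1 hk h => // c v; case/lastP: v => // r d _.
move=> hk h; move: (h); rewrite /= size_rcons in hk.
rewrite ext_cons ext_rcons => /infixP[p [q]].
case/cat_eq_cat=> [[z _ e]|[c' [z [e e']]]].
  have [||v' [h1 h2 h3]] := IH (rcons r d); first by rewrite size_rcons; lia.
    by rewrite ext_rcons e infix_infix.
  by exists v'; split=> //; exact: infix_trans h1 (infix_cons _ _).
move: e'; rewrite catA -cat_cons => /cat_eq_cat[[z' e' _]|[c'' [z' [e' _]]]].
  have [||v' [h1 h2 h3]] := IH (c :: r); first by rewrite /=; lia.
    by rewrite ext_cons e -catA cat_cons e' infix_infix.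
  have h4 : infix (c :: r) (c :: rcons r d) by rewrite -cats1 -cat_cons prefix_infix.
  by exists v'; split=> //; exact: infix_trans h1 h4.
exists (c :: rcons r d); split; [exact: infix_refl | exact: h |].
right; exists c, r, d; split=> //; rewrite e'.
  by rewrite -cat_cons -catA infix_infix.
by rewrite !size_cat /= size_cat; lia.
Qed.

(** * Linear recurrence *)

Section LinearRecurrence.

Variables (A B : finType) (s : A -> seq A) (phi : A -> seq B) (a : A) (u : seq A).
Variable x : nat -> B.
Hypothesis nf : normal_form s phi a u x.
Hypothesis ur : uniformly_recurrent x.
Hypothesis aper : ~ purely_periodic x.

Local Notation stat := (stationary s).
Local Notation len := (image_len s phi).

Let s_gt0 := nf_gt0 nf.
Let phi_gt0 := nf_phi_gt0 nf.
Let sa := nf_start nf.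
Let idem := nf_idem nf.

Let lenE m w : size (ext (fun b => ext phi (iter_word s m b)) w) = len m w.
Proof. by rewrite -ext_comp -iter_ext. Qed.

Let imageE m k c : ext (fun b => ext phi (iter_word s m b)) (iter_word s k c) =
  ext phi (iter_word s (m + k) c).
Proof. by rewrite -ext_comp -iter_ext /iter_word iterD. Qed.

(** For each [l] one takes the least scale [m] at which all nonstationary letters of [s c0] have
    images of length at least [l]. These letters occur in each other's images, so minimality bounds
    all images of letters of [s c0] at scale [m] by a constant times [l]. *)
Lemma exists_linearly_recurrent : exists K, linearly_recurrent x K.
Proof.
have [K K0 hK] := image_len_ratio s_gt0 phi_gt0.
have hKj j n w : len (n + j) w <= K ^ j * len n w.
  by apply: image_len_ratio_iter => n' w'; have [] := hK n' w'.
have [L hL] := stationary_runs_bounded nf ur aper.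
have [c0 [c0a c00 nc0 hc0]] := minimal_letter nf.
have mem_c0 j c : c \in iter_word s j c0 -> c \in s c0.
  case: j => [|j]; first by rewrite inE => /eqP ->.
  by rewrite alphabet_idempotent_iter.
have in_y j : infix (iter_word s j c0) (iter_word s j.+1 a) by exact: iter_word_mem.
have fac j : factor (ext phi (iter_word s j c0)) x.
  exact: (factor_image0 nf (in_y j)).
have grow0 n : n <= size (ext phi (iter_word s n c0)).
  exact: (nonstationary_growth nf n nc0).
have mono0 i j : i <= j -> infix (iter_word s i c0) (iter_word s j c0).
  move=> /subnK <-; elim: (j - i) => [|k IH]; first exact: infix_refl.
  by apply: infix_trans IH _; rewrite addSn; exact: iter_word_mem.
(* Finitely many short words are involved and each one persists, because [c0] occurs in [s c0]. The
   length [L.+2] is that of a stationary run with its two end letters. *)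
have [J hJ] : exists J, forall v j, size v <= L.+2 ->
    infix v (iter_word s j c0) -> infix v (iter_word s J c0).
  have /fin_eventually[J hJ] : forall v : L.+2.-bseq A, exists n, forall m, n <= m ->
      (exists j, infix (v : seq A) (iter_word s j c0)) ->
      infix (v : seq A) (iter_word s m c0).
    move=> v; case: (classic (exists j, infix (v : seq A) (iter_word s j c0))).
      by case=> j hj; exists j => m jm _; exact: infix_trans hj (mono0 _ _ jm).
    by move=> h; exists 0.
  by exists J => v j vL hv; apply: (hJ (Bseq vL) J (leqnn J)); exists j.
(* A factor [w] of [x] either lies in the image under [phi \o s^m] of a short
   word, or contains the image of a nonstationary letter. *)
have cover m w : factor w x -> exists v j, [/\ infix v (iter_word s j c0),
    infix w (ext (fun b => ext phi (iter_word s m b)) v) &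
    size v <= L.+2 \/ exists2 c, [&& c \in s c0, ~~ stat c & len m [:: c] < size w] &
      infix (ext phi (iter_word s m c)) w].
  move=> fw; have [R hR] := uniformly_recurrent_infix ur fw.
  have := hR _ (fac (m + R)) (leq_trans (leq_addl m R) (grow0 _)).
  rewrite -imageE => /infix_ext_cover[v [h1 h2 h3]]; exists v, R; split=> //.
  case: h3 => [h3|[c [r [d [vE h4 h5]]]]]; first by left; lia.
  case: (boolP (all stat r)) => Sr.
    left; rewrite vE /= size_rcons !ltnS; apply: (hL R.+1) => //.
    apply: infix_trans (in_y R); apply: infix_trans h1.
    by rewrite vE -cats1 -cat1s infix_infix.
  right; case/allPn: Sr => c' c'r nc'.
  have hm := infix_mem_ext (fun b => ext phi (iter_word s m b)) c'r.
  exists c'; last by apply: infix_trans hm h4.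
  rewrite nc' /=; apply/andP; split.
    apply: (mem_c0 R); apply: (mem_infix h1).
    by rewrite vE inE mem_rcons inE c'r !orbT.
  by apply: leq_ltn_trans (size_infix hm) h5.
pose mx := \max_c len 0 [:: c].
(* [(K ^ 2 + mx) * l] bounds the images at scale [m], with [mx] for [m = 0], and [K ^ J.+1] pays for
   [J.+1] further steps. A window longer than [L.+2] such images contains a complete image of a
   nonstationary letter. *)
pose D := K ^ J.+1 * (K ^ 2 + mx); exists (L.+2 * D).+1 => l i j l0.
have ex : exists m, [forall c, (c \in s c0) && ~~ stat c ==> (l <= len m [:: c])].
  exists l; apply/forallP=> c; apply/implyP=> /andP[_ nc].
  exact: (nonstationary_growth nf l nc).
case: (ex_minnP ex) => m /forallP m_big m_min.
have m_small c : c \in s c0 -> len m [:: c] <= (K ^ 2 + mx) * l.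
  move=> cc0; case: m m_min {m_big} => [|m] m_min.
    apply: leq_trans (_ : mx <= _); last by nia.
    exact: (leq_bigmax c (F := fun c => len 0 [:: c])).
  have : ~~ [forall c, (c \in s c0) && ~~ stat c ==> (l <= len m [:: c])].
    by apply/negP=> /m_min; rewrite ltnn.
  case/forallPn=> c'; rewrite negb_imply -ltnNge => /andP[/andP[c'c0 nc'] hc'].
  have cc' : c \in s c' by rewrite hc0.
  have h1 : len m.+1 [:: c] <= len m.+2 [:: c'].
    by rewrite (image_lenS1 _ _ m.+1); exact: image_len_mem.
  apply: leq_trans h1 _; rewrite -addn2; apply: leq_trans (hKj 2 m [:: c']) _.
  by rewrite leq_mul // ?leq_addr // ltnW.
have w_in c : c \in s c0 -> ~~ stat c ->
    infix (slice x j l) (ext phi (iter_word s (m + J.+1) c)).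
  move=> cc0 nc; have [v [k [h1 h2 h3]]] := cover m _ (factor_slice x j l).
  case: h3 => [h3|[c' /and3P[c'c0 nc']]]; last first.
    by have /implyP/(_ _) := m_big c'; rewrite c'c0 nc' size_slice ltnNge => ->.
  have c0c : c0 \in s c by rewrite hc0.
  apply: infix_trans h2 _; rewrite -imageE; apply: infix_ext.
  apply: infix_trans (hJ v k h3 h1) _; exact: iter_word_mem.
have [v [k [h1 h2 h3]]] := cover (m + J.+1) _ (factor_slice x i ((L.+2 * D).+1 * l)).
have : infix (slice x j l) (slice x i ((L.+2 * D).+1 * l)).
  case: h3 => [h3|[c /and3P[cc0 nc _] hc]]; last exact: infix_trans (w_in c cc0 nc) hc.
  exfalso; have := size_infix h2; rewrite lenE size_slice leqNgt => /negP; apply.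
  apply: leq_ltn_trans (_ : D * l * size v < _).
    apply: image_len_bound => c cv.
    have cc0 : c \in s c0 by apply: (mem_c0 k); exact: (mem_infix h1).
    apply: leq_trans (hKj _ _ _) _; rewrite /D -mulnA leq_mul2l.
    by rewrite m_small // orbT.
  apply: leq_ltn_trans (_ : D * l * L.+2 < _); first by rewrite leq_mul2l h3 orbT.
  by rewrite mulSn mulnAC [D * _]mulnC; lia.
case/infix_slice=> q [iq ql oq]; exists q; rewrite size_slice in ql; split=> //.
by move: oq; rewrite /occurs_at size_slice.
Qed.

(* Two nonstationary letters in [s c0] make [c0] double; a single one would
   produce stationary runs of unbounded length. *)
Let doubling : exists c0, c0 \in s a /\ forall n, 2 ^ n <= len (n + n) [:: c0].
Proof.
have [L hL] := stationary_runs_bounded nf ur aper.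
have [c0 [c0a c00 nc0 hc0]] := minimal_letter nf.
exists c0; split=> //.
have [p [q E]] : exists p q : seq A, s c0 = p ++ c0 :: q.
  by case/splitPr: c00 => p q; exists p, q.
case: (boolP (all stat (p ++ q))) => Spq.
  exfalso; move: Spq; rewrite all_cat => /andP[Sp Sq].
  have pq : 0 < size p + size q.
    rewrite lt0n addn_eq0 !size_eq0; apply/negP=> /andP[/eqP p0 /eqP q0].
    by move: nc0; rewrite /stationary E p0 q0 /= E p0 q0 eqxx.
  have ex n : exists P Q : seq A, [/\ iter_word s n c0 = P ++ c0 :: Q,
      all stat P, all stat Q & n <= size P + size Q].
    elim: n => [|n [P [Q [e SP SQ h]]]]; first by exists [::], [::].
    exists (ext s P ++ p), (q ++ ext s Q); split.
    - rewrite /iter_word iterS -/(iter_word s n c0) e ext_cat ext_cons E.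
      by rewrite -!catA.
    - by rewrite all_cat Sp stationary_ext.
    - by rewrite all_cat Sq stationary_ext.
    - rewrite !size_cat; have := size_ext_ge P s_gt0; have := size_ext_ge Q s_gt0.
      by lia.
  have [P [Q [e SP SQ]]] := ex (L + L).+1; rewrite ltnNge => /negP; apply.
  have hy : infix (P ++ c0 :: Q) (iter_word s (L + L).+2 a).
    by rewrite -e; exact: iter_word_mem.
  apply: leq_add; apply: hL.
  - exact: SP.
  - exact: catr_infix hy.
  - exact: SQ.
  - exact: consl_infix (catl_infix hy).
case/allPn: Spq => d dpq nd.
have c0d : c0 \in s d.
  rewrite hc0 //; move: dpq; rewrite E !mem_cat inE => /orP[->//|->].
  by rewrite !orbT.
elim=> [|n IH]; first exact: leq_trans (image_len_ge s_gt0 phi_gt0 0 [:: c0]).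
rewrite addSn addnS image_lenS1 expnS mul2n -addnn.
have h1 : len (n + n) [:: c0] <= len (n + n).+1 [:: c0].
  by rewrite image_lenS1; exact: image_len_mem.
have h2 : len (n + n) [:: c0] <= len (n + n).+1 [:: d].
  by rewrite image_lenS1; exact: image_len_mem.
rewrite E image_len_cat (image_len_cons _ _ _ c0).
have h3 : len (n + n).+1 [:: d] <= len (n + n).+1 (p ++ q) by exact: image_len_mem.
rewrite addnCA -image_len_cat; apply: leq_add; first exact: leq_trans IH h1.
exact: leq_trans IH (leq_trans h2 h3).
Qed.

(* Otherwise [len n [:: a]] would grow at most like [(4/3)^n], more slowly than
   the [2^(n/2)] provided by [doubling]. *)
Lemma infinite_tail_large : infinite (fun n => len n [:: a] <= 3 * len n u).
Proof.
apply: NNPP => /not_infinite[N hN].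
have [c0 [c0a dbl]] := doubling.
(* Two exponents at a time, as in [doubling]: the factor is at most [16/9], which is below 2. *)
have up k : 9 ^ k * len (N + (k + k)) [:: a] <= 16 ^ k * len N [:: a].
  elim: k => [|k IH]; first by rewrite !expn0 !addn0.
  have st n : N <= n -> 3 * len n.+1 [:: a] <= 4 * len n [:: a].
    move=> Nn; have := hN n Nn; rewrite image_lenS1 sa (image_len_cons _ _ _ a u); lia.
  have := st (N + (k + k)) (leq_addr _ _).
  have := st (N + (k + k)).+1 (leqW (leq_addr _ _)).
  rewrite !expnS [k.+1 + _]addSn !addnS => h1 h2.
  set P := 9 ^ k in IH *; set X := len (N + (k + k)).+2 _ in h1 *.
  set Y := len _ _ in IH h2; set Z := 16 ^ k * _ in IH.
  have h3 : 9 * X <= 16 * Y by lia.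
  have -> : 9 * P * X = P * (9 * X) by lia.
  have -> : 16 * 16 ^ k * len N [:: a] = 16 * Z by rewrite /Z mulnA.
  apply: leq_trans (_ : P * (16 * Y) <= _); first by rewrite leq_mul2l h3 orbT.
  by rewrite mulnCA leq_mul2l IH orbT.
have low k : 2 ^ k <= len (N + (k.+1 + k.+1)) [:: a].
  have h n : len n [:: a] <= len n.+1 [:: a].
    by rewrite image_lenS1 sa; apply: image_len_mem; exact: mem_head.
  have h1 : len (k + k) [:: c0] <= len (k + k).+1 [:: a].
    by rewrite image_lenS1; exact: image_len_mem.
  have h2 n m : len n [:: a] <= len (m + n) [:: a].
    by elim: m => [|m IH] //; exact: leq_trans IH (h _).
  apply: leq_trans (dbl k) _; apply: leq_trans h1 _.
  have -> : N + (k.+1 + k.+1) = N.+1 + (k + k).+1 by lia.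
  exact: h2.
pose C := 16 * len N [:: a].
have main k : 18 ^ k * 9 <= 16 ^ k * C.
  have := up k.+1; rewrite /C !expnS => h.
  have := low k => h'; have -> : 18 ^ k = 9 ^ k * 2 ^ k by rewrite -expnMn.
  have : 9 ^ k * 2 ^ k <= 9 ^ k * len (N + (k.+1 + k.+1)) [:: a].
    by rewrite leq_mul2l h' orbT.
  by move: h; rewrite -!mulnA [16 * (_ * _)]mulnCA; lia.
(* Bernoulli's inequality for [(9/8)^k]; with [k = C] it contradicts [main]. *)
have bern k : 16 ^ k * (8 + k) <= 18 ^ k * 8.
  elim: k => [|k IH] //; rewrite !expnS.
  have h : 0 < 16 ^ k by rewrite expn_gt0.
  by move: IH h; move: (16 ^ k) (18 ^ k) => P Q; nia.
have := main C; have := bern C.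
have : 0 < 16 ^ C by rewrite expn_gt0.
by move: (16 ^ C) (18 ^ C) => P Q; nia.
Qed.

End LinearRecurrence.

(** * Comparison of growth rates *)

Lemma linearly_recurrent_gt0 (B : finType) (x : nat -> B) K :
  linearly_recurrent x K -> 0 < K.
Proof. by move=> /(_ 1 0 0 isT)[k [_ + _]]; lia. Qed.

(** The bound does not depend on the scale [G]. The spacing given to [occ_count] is [G %/ (c * K)],
    positive by the hypothesis [c * K <= G]; the factor 2 absorbs the rounding. *)
Lemma occ_count_scaled (B : finType) (x : nat -> B) K c G m U P :
  linearly_recurrent x K -> ~ purely_periodic x ->
  0 < c -> c * K <= G -> G <= c * size U ->
  count (occ x U) (iota P (m * G)) <= m * (2 * (c * K)) + 1.
Proof.
move=> lr aper c0 cK GU; have K0 := linearly_recurrent_gt0 lr.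
have cK0 : 0 < c * K by rewrite muln_gt0 c0.
set g := G %/ (c * K).
have g0 : 0 < g by rewrite divn_gt0.
have g1 : g * (c * K) <= G by exact: leq_trunc_div.
have g2 : G <= g * (2 * (c * K)).
  have := ltn_ceil G cK0; rewrite -/g => h; nia.
have hU : K * g <= size U.
  rewrite -(leq_pmul2l c0); apply: leq_trans GU; apply: leq_trans g1; lia.
have := occ_count P (m * G) lr aper hU => h.
rewrite -(leq_pmul2r g0); apply: leq_trans h _.
have : m * G <= m * (g * (2 * (c * K))) by rewrite leq_mul2l g2 orbT.
by rewrite mulnDl mul1n leq_add2r [m * (g * _)]mulnA [m * (2 * _) * g]mulnAC.
Qed.

Lemma infinite_uniq_seq (I : nat -> Prop) m : infinite I ->
  exists ks, [/\ size ks = m, uniq ks & forall k, k \in ks -> I k].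
Proof.
move=> inf; elim: m => [|m [ks [sz un h]]]; first by exists [::].
have [n hn In] := inf (\max_(k <- ks) k).+1.
exists (n :: ks); split=> /=; first by rewrite sz.
  rewrite un andbT; apply/negP=> nks.
  by have := @leq_bigmax_seq _ ks xpredT id n nks isT; rewrite leqNgt hn.
by move=> k; rewrite inE => /orP[/eqP ->|/h].
Qed.

Section BigAndSmall.

Variables (A B : finType) (s : A -> seq A) (phi : A -> seq B) (a : A) (u : seq A).
Variable x : nat -> B.
Hypothesis nf : normal_form s phi a u x.
Hypothesis ur : uniformly_recurrent x.
Hypothesis aper : ~ purely_periodic x.

Local Notation stat := (stationary s).
Local Notation len := (image_len s phi).

Let s_gt0 := nf_gt0 nf.
Let phi_gt0 := nf_phi_gt0 nf.
Let sa := nf_start nf.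
Let idem := nf_idem nf.

Definition small_on (I : nat -> Prop) b :=
  forall M, exists N, forall n, N <= n -> I n -> M * len n [:: b] <= len n [:: a].

Definition big_on (I : nat -> Prop) b :=
  exists c, forall n, I n -> len n [:: a] <= c * len n [:: b].

(* Comparing the growth of every letter with that of [a] is made possible by
   passing to an infinite set of exponents, instead of computing growth rates. *)
Lemma big_or_small : exists I (S : pred A),
  [/\ infinite I, (forall n, I n -> len n [:: a] <= 3 * len n u),
      (forall b, S b -> small_on I b) &
      exists2 c, 0 < c &
        forall b, ~~ S b -> forall n, I n -> len n [:: a] <= c * len n [:: b]].
Proof.
have [I [Iinf Iu bs]] : exists I, [/\ infinite I,
    (forall n, I n -> len n [:: a] <= 3 * len n u) &
    forall b, b \in enum A -> small_on I b \/ big_on I b].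
  elim: (enum A) => [|b l [I [Iinf Iu bs]]].
    exists (fun n => len n [:: a] <= 3 * len n u); split=> //.
    exact: (infinite_tail_large nf ur aper).
  case: (classic (exists c, infinite (fun n => I n /\ len n [:: a] <= c * len n [:: b]))).
    move=> [c cinf]; exists (fun n => I n /\ len n [:: a] <= c * len n [:: b]).
    split=> //; first by move=> n [/Iu].
    move=> d; rewrite inE => /orP[/eqP ->|/bs[sd|[c' hc']]].
    - by right; exists c => n [].
    - by left=> M; have [N hN] := sd M; exists N => n Nn [In _]; exact: hN.
    - by right; exists c' => n [In _]; exact: hc'.
  move=> nc; exists I; split=> // d; rewrite inE => /orP[/eqP ->|/bs //].
  left=> M.
  have [|N hN] := @not_infinite (fun n => I n /\ len n [:: a] <= M * len n [:: b]).
    by move=> h; apply: nc; exists M.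
  exists N => n Nn In; apply: ltnW; rewrite ltnNge; apply/negP=> h.
  by apply: (hN n Nn).
have /fin_all_exists[S hS] : forall b, exists S : bool,
    (S -> small_on I b) /\ (~~ S -> big_on I b).
  by move=> b; case: (bs b); rewrite ?mem_enum // => h; [exists true | exists false].
exists I, S; split=> //; first by move=> b; case: (hS b).
have /fin_all_exists[c hc] : forall b, exists c, ~~ S b -> forall n, I n ->
    len n [:: a] <= c * len n [:: b].
  move=> b; case: (boolP (S b)) => Sb; first by exists 0.
  by have [_ /(_ Sb)[c hc]] := hS b; exists c.
exists (\max_b c b).+1 => // b nb n In; apply: leq_trans (hc b nb n In) _.
by rewrite leq_mul2r; apply/orP; right; apply: leqW; exact: leq_bigmax.
Qed.

Variables (I : nat -> Prop) (S : pred A) (c : nat).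
Hypothesis I_inf : infinite I.
Hypothesis I_u : forall n, I n -> len n [:: a] <= 3 * len n u.
Hypothesis S_small : forall b, S b -> small_on I b.
Hypothesis c_gt0 : 0 < c.
Hypothesis S_big : forall b, ~~ S b -> forall n, I n -> len n [:: a] <= c * len n [:: b].

Lemma small_word w : all S w ->
  forall M, exists N, forall n, N <= n -> I n -> M * len n w <= len n [:: a].
Proof.
move=> Sw M; have /fin_eventually[N hN] : forall b, exists N, forall n, N <= n ->
    S b -> I n -> (M * size w) * len n [:: b] <= len n [:: a].
  move=> b; case: (boolP (S b)) => [/S_small/(_ (M * size w))[N hN]|nb].
    by exists N => n Nn _; exact: hN.
  by exists 0.
exists N => n Nn In; case: (posnP (size w)) => [/size0nil ->|w0].
  by rewrite image_len_nil muln0.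
rewrite -(leq_pmul2r w0) mulnAC.
have : {in w, forall b, (M * size w) * len n [:: b] <= len n [:: a]}.
  by move=> b bw; apply: hN => //; exact: (allP Sw).
move: (M * size w) => k; elim: (w) => [|b v IH] h; first by rewrite image_len_nil muln0.
rewrite image_len_cons mulnDr /= mulnS; apply: leq_add.
  by apply: h; exact: mem_head.
by apply: IH => d dv; apply: h; rewrite inE dv orbT.
Qed.

Let len_pos n w : 0 < size w -> 0 < len n w.
Proof. by move=> h; apply: leq_trans h _; exact: image_len_ge. Qed.

(** One more exponent changes lengths by a bounded factor, so a big letter in [s b] would prevent
    [b] from being negligible. The same comparison gives [small_compl]. *)
Lemma small_closed b : S b -> all S (s b).
Proof.
move=> Sb; apply/negPn/negP=> /allPn[d db nd].
have [K K0 hK] := image_len_ratio s_gt0 phi_gt0.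
have [N hN] := S_small Sb (c * K).+1; have [n Nn In] := I_inf N.
have h1 := hN n Nn In; have h2 := S_big nd In.
have h3 : len n [:: d] <= K * len n [:: b].
  apply: leq_trans (image_len_mem s phi n db) _; rewrite -image_lenS1.
  by have [] := hK n [:: b].
have h4 : c * len n [:: d] <= c * (K * len n [:: b]) by rewrite leq_mul2l h3 orbT.
have := leq_trans h1 (leq_trans h2 h4).
by rewrite mulnA leq_pmul2r ?ltnn // len_pos.
Qed.

Lemma small_compl b : ~~ S b -> ~~ all S (s b).
Proof.
move=> nb; apply/negP=> Sb.
have [K K0 hK] := image_len_ratio s_gt0 phi_gt0.
have [N hN] := small_word Sb (c * K).+1; have [n Nn In] := I_inf N.
have h1 := hN n Nn In; have h2 := S_big nb In.
have h3 : len n [:: b] <= K * len n (s b).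
  by rewrite -image_lenS1; have [] := hK n [:: b].
have h4 : c * len n [:: b] <= c * (K * len n (s b)) by rewrite leq_mul2l h3 orbT.
have := leq_trans h1 (leq_trans h2 h4).
by rewrite mulnA leq_pmul2r ?ltnn // len_pos.
Qed.

Lemma start_big : ~~ S a.
Proof.
apply/negP=> /S_small/(_ 2)[N hN]; have [n Nn In] := I_inf N.
by have := hN n Nn In; have := @len_pos n [:: a] isT; lia.
Qed.

(** This is what [infinite_tail_large] was for: [u] keeps at least a third of the length of [a]
    along [I]. *)
Lemma tail_big : ~~ all S u.
Proof.
apply/negP=> /small_word/(_ 4)[N hN]; have [n Nn In] := I_inf N.
have := hN n Nn In; have := I_u In; have := len_pos n (nf_u_gt0 nf); lia.
Qed.

(* Along an unbounded chain of runs between two fixed big letters [e] and [b],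
   the words [phi (s^n (e r b))] put an occurrence of the image of [b] at
   arbitrarily many small distances from one of the image of [e], whereas
   linear recurrence bounds the number of such distances. *)
Lemma small_runs_bounded :
  exists L, forall n w, all S w -> infix w (iter_word s n a) -> size w <= L.
Proof.
have [//|[t0 [n0 [hrun hunb]]]] :=
  runs_dichotomy small_closed small_compl sa start_big tail_big.
exfalso.
have fits i n1 n2 n3 M : i + (n1 + (n2 + n3)) <= M -> 0 < n3 ->
    i < M /\ i + n1 + n2 < M by lia.
have [K K0 hK] := image_len_ratio s_gt0 phi_gt0.
have [KK lr] := exists_linearly_recurrent nf ur aper.
pose t k := iter k (run_step s S) t0; pose r k := (t k).1.2.
pose q k := run_suffix s S (t k).1.1; pose p k := run_prefix s S (t k).2.
have rS k : r k.+1 = q k ++ ext s (r k) ++ p k by [].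
(* At a strict step the length of the run image increases for every exponent from [#|A|] on, so
   distinct strict steps yield distinct distances. *)
pose strict k := ~~ [&& all stat (r k), nilp (q k) & nilp (p k)].
have mono n k : #|A| <= n -> len n (r k) <= len n (r k.+1).
  move=> hn; rewrite rS !image_len_cat -image_lenS.
  by have := image_len_mono s_gt0 phi_gt0 idem (r k) hn; lia.
have monoD n k j : #|A| <= n -> len n (r k) <= len n (r (k + j)).
  move=> hn; elim: j => [|j IH]; rewrite ?addn0 // addnS.
  exact: leq_trans IH (mono _ _ hn).
have smono n k : #|A| <= n -> strict k -> len n (r k) < len n (r k.+1).
  move=> hn; rewrite /strict rS !image_len_cat -image_lenS !negb_and /nilp -!lt0n.
  have m := image_len_mono s_gt0 phi_gt0 idem (r k) hn.
  case/or3P=> [h|h|h].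
  - by have := image_len_strict s_gt0 phi_gt0 idem hn h; lia.
  - by have := len_pos n h; lia.
  - by have := len_pos n h; lia.
have strict_inf : infinite strict.
  apply: NNPP => /not_infinite[k0 hk0].
  have ns k : k0 <= k -> all stat (r k) /\ r k.+1 = ext s (r k).
    move=> /hk0/negP; rewrite negbK => /and3P[h /nilP h1 /nilP h2]; split=> //.
    by rewrite rS h1 h2 cats0.
  have cst j : r (k0.+1 + j) = ext s (r k0).
    elim: j => [|j IH]; first by rewrite addn0; have [] := ns k0 (leqnn _).
    have [] := ns (k0.+1 + j); first by lia.
    rewrite addnS => _ ->; rewrite IH stationary_ext_idem //.
    by have [] := ns k0 (leqnn _).
  have sz k j : size (r k) <= size (r (k + j)).
    elim: j => [|j IH]; rewrite ?addn0 // addnS; apply: leq_trans IH _.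
    by rewrite rS !size_cat; have := size_ext_ge (r (k + j)) s_gt0; lia.
  have [k] := hunb (size (ext s (r k0))); rewrite -/(t k) -/(r k) ltnNge => /negP; apply.
  by rewrite -(cst k) addnC; exact: sz.
have [[e b] eb_inf] := infinite_pigeonhole (fun k => ((t k).1.1, (t k).2)) strict_inf.
(* The images [U] and [V] of the end letters have length at most [K * G] and that of the run at most
   [G]; hence the first [m * G] positions see all the words [U R V]. [Q] bounds the number of pairs
   of occurrences of [U] and [V] there, and [Q.+1] runs give too many distances. *)
pose m := KK * (2 * K).+1.
pose Q := (m * (2 * (c * KK)) + 1) * (m * (2 * (c * KK)) + 1).
have [ks [sz_ks un_ks hks]] := infinite_uniq_seq Q.+1 eb_inf.
have runk k : run S (t k) (iter_word s (n0 + k) a) by exact: hrun.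
have [N hN] : exists N, forall n k, N <= n -> I n -> k \in ks ->
    len n (r k) <= len n [:: a].
  elim: (ks) => [|k l [N hN]]; first by exists 0.
  have [_ _ Sr _] := runk k; have [N' hN'] := small_word Sr 1.
  exists (N + N') => n j Nn In; rewrite inE => /orP[/eqP ->|jl].
    by rewrite -[len n (r k)]mul1n; apply: hN' => //; lia.
  by apply: hN => //; lia.
(* [N] makes the chosen run images no longer than [G], [#|A|] is for monotonicity, and [c * KK] for
   [occ_count_scaled]. *)
have [n Nn In] := I_inf (N + #|A| + c * KK).
set G := len n [:: a].
have Gn : n <= G by exact: (nonstationary_growth nf n (start_nonstationary nf)).
have G0 : 0 < G by exact: len_pos.
pose U := ext phi (iter_word s n e); pose V := ext phi (iter_word s n b).
have [k1 hk1] : exists k, k \in ks.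
  by case: (ks) sz_ks => // k l _; exists k; exact: mem_head.
have [_ [e1 b1]] := hks k1 hk1.
have [ne nb _ inf1] := runk k1; rewrite e1 b1 in ne nb inf1.
have upper d : d \in iter_word s (n0 + k1) a -> len n [:: d] <= K * G.
  case: (n0 + k1) => [|j]; first by rewrite inE => /eqP ->; rewrite leq_pmull.
  rewrite alphabet_idempotent_iter // => da.
  apply: leq_trans (image_len_mem s phi n da) _; rewrite -image_lenS1.
  by have [] := hK n [:: a].
have Uup : size U <= K * G by apply: upper; apply: (mem_infix inf1); rewrite mem_head.
have Vup : size V <= K * G.
  by apply: upper; apply: (mem_infix inf1); rewrite inE mem_cat mem_head !orbT.
have cU : G <= c * size U by exact: S_big.
have cV : G <= c * size V by exact: S_big.
have cKG : c * KK <= G by lia.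
have cntU := occ_count_scaled m 0 lr aper c_gt0 cKG cU.
have cntV := occ_count_scaled m 0 lr aper c_gt0 cKG cV.
pose oU := filter (occ x U) (iota 0 (m * G)).
pose oV := filter (occ x V) (iota 0 (m * G)).
pose D := [seq j - i | i <- oU, j <- oV].
have szD : size D <= Q by rewrite size_allpairs !size_filter leq_mul.
have : size [seq size U + len n (r k) | k <- ks] <= size D.
  apply: uniq_leq_size.
    rewrite map_inj_in_uniq // => k k' hk hk' /addnI.
    wlog lt : k k' hk hk' / k < k'.
      move=> H h; case: (ltngtP k k') => // lt; first exact: H.
      by apply/esym; apply: H.
    have [st _] := hks k hk; have hA : #|A| <= n by lia.
    have := smono n k hA st; have := monoD n k.+1 (k' - k.+1) hA.
    by rewrite subnKC // => h1 h2 h3; lia.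
  move=> d /mapP[k hk ->].
  have [st [ek bk]] := hks k hk.
  have [_ _ _ infk] := runk k; rewrite ek bk -/(r k) in infk.
  have [j oj] := factor_image nf n infk.
  rewrite -cat1s !iter_ext_cat !ext_cat -/U -/V in oj.
  set R := ext phi (iter n (ext s) (r k)) in oj.
  have szR : size R <= G by apply: hN => //; lia.
  have sizeE : size (U ++ R ++ V) <= (2 * K).+1 * G.
    by rewrite !size_cat; lia.
  have [i [_ iW e_i]] := lr ((2 * K).+1 * G) 0 j ltac:(lia).
  have oi : occ x (U ++ R ++ V) i.
    by rewrite (occ_window e_i sizeE); apply/occP.
  move: oi; rewrite /occ !size_cat !sliceD eqseq_cat ?size_slice //.
  case/andP=> oiU; rewrite eqseq_cat ?size_slice // => /andP[_ oiV].
  have V0 : 0 < size V by exact: (@len_pos n [:: b] isT).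
  have -> : size U + len n (r k) = (i + size U + size R) - i by rewrite -addnA addKn.
  rewrite !size_cat -(leq_add2l i) in sizeE.
  rewrite add0n mulnA -/m in iW.
  have [iG jG] := fits _ _ _ _ _ (leq_trans sizeE iW) V0.
  apply: allpairs_f; rewrite mem_filter mem_iota add0n leq0n ?iG ?jG !andbT.
    exact: oiU.
  exact: oiV.
by rewrite size_map sz_ks ltnNge szD.
Qed.

End BigAndSmall.

(** * Return words *)

Section ReturnWords.

Variables (B : finType) (x : nat -> B) (K : nat) (U : seq B).
Hypothesis lr : linearly_recurrent x K.
Hypothesis U_prefix : occ x U 0.
Hypothesis U_gt0 : 0 < size U.

Local Notation sl := (slice x).
Local Notation cut := (occ x U).

Definition return_bound := K * size U.
Local Notation R := return_bound.

Definition next_cut j := j.+1 + find (fun d => cut (j.+1 + d)) (iota 0 R).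

Lemma next_cutP j :
  [/\ cut (next_cut j), j < next_cut j <= j + R &
      forall k, j < k < next_cut j -> ~~ cut k].
Proof.
have hs : has (fun d => cut (j.+1 + d)) (iota 0 R).
  have [k [jk kU e]] := lr j.+1 0 U_gt0; apply/hasP; exists (k - j.+1).
    by rewrite mem_iota; move: jk kU; rewrite /R; lia.
  by rewrite subnKC // (occ_window e (leqnn _)).
have hf := hs; rewrite has_find size_iota in hf.
split.
- by have := nth_find 0 hs; rewrite nth_iota.
- by rewrite /next_cut; lia.
- move=> k /andP[jk]; rewrite /next_cut => kn.
  have hk : k - j.+1 < find (fun d => cut (j.+1 + d)) (iota 0 R) by lia.
  have := before_find 0 hk; rewrite nth_iota; last by lia.
  by rewrite add0n subnKC // => ->.
Qed.

(** Stated for any [F] additive on intervals, since it serves both for slices of [x] and for label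
    words of another scale cut at the occurrences of [U]. *)
Lemma cut_decomposition (T : Type) (F : nat -> nat -> seq T) :
  (forall i d1 d2, F i (d1 + d2) = F i d1 ++ F (i + d1) d2) -> (forall i, F i 0 = [::]) ->
  forall i d, cut i -> cut (i + d) ->
    F i d = flatten [seq F j (next_cut j - j) | j <- iota i d & cut j].
Proof.
move=> FD F0 i d; have [k] := ubnP d; elim: k i d => // k IH i d dk ci cd.
case: d dk cd => [|d] dk cd; first by rewrite F0.
have [cn /andP[n1 n2] nc] := next_cutP i.
have nd : next_cut i <= i + d.+1.
  rewrite leqNgt; apply/negP=> h; have := nc (i + d.+1).
  by rewrite h cd addnS ltnS leq_addr => /(_ isT).
set e := next_cut i - i; have e0 : 0 < e by rewrite subn_gt0.
have ie : i + e = next_cut i by rewrite /e; lia.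
have cd' : cut (next_cut i + (d.+1 - e)).
  by have -> : next_cut i + (d.+1 - e) = i + d.+1 by lia.
have lk : d.+1 - e < k by lia.
have -> : d.+1 = e + (d.+1 - e) by lia.
rewrite FD iotaD filter_cat map_cat flatten_cat ie -(IH _ _ lk cn cd').
congr (_ ++ _); have -> : e = 1 + e.-1 by lia.
rewrite iotaD filter_cat map_cat flatten_cat /= ci /= cats0.
rewrite (_ : [seq j <- _ | _] = [::]) ?cats0; last first.
  rewrite -(filter_pred0 (iota (i + 1) e.-1)); apply: eq_in_filter => j.
  rewrite mem_iota => hj; apply/negbTE; apply: nc; lia.
by rewrite add1n prednK.
Qed.

Definition return_word j := sl j (next_cut j - j).

Lemma size_return_word j : size (return_word j) = next_cut j - j.
Proof. exact: size_slice. Qed.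

(** The next cut comes within [R] positions, and recognizing it takes [size U] more letters. *)
Lemma cut_local P P' W d : sl P W = sl P' W -> d + (R + size U) <= W ->
  [/\ cut (P + d) = cut (P' + d),
      next_cut (P + d) - (P + d) = next_cut (P' + d) - (P' + d) &
      return_word (P + d) = return_word (P' + d)].
Proof.
move=> e hd.
have c1 k : k + size U <= W -> cut (P + k) = cut (P' + k).
  by move=> hk; apply: (@occ_window _ _ _ _ _ (size U)) => //; exact: eq_slice_sub e _.
have n1 : next_cut (P + d) - (P + d) = next_cut (P' + d) - (P' + d).
  have nE Q : next_cut (Q + d) - (Q + d) =
      (find (fun k => cut (Q + (d.+1 + k))) (iota 0 R)).+1.
    rewrite /next_cut (eq_find (a2 := fun k => cut (Q + (d.+1 + k)))); first by lia.
    by move=> k; rewrite /= addnA addnS.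
  rewrite !nE; congr _.+1; apply: eq_in_find => k; rewrite mem_iota => hk.
  by apply: c1; lia.
split=> //; first by apply: c1; lia.
rewrite /return_word n1; apply: (eq_slice_sub e).
by have [_ /andP[_ h] _] := next_cutP (P' + d); lia.
Qed.

Definition label_window := K * (R + size U).

Definition return_words :=
  undup [seq return_word j | j <- iota 0 label_window & cut j].

Lemma size_return_words : size return_words <= count cut (iota 0 label_window).
Proof. by apply: leq_trans (size_undup _) _; rewrite size_map size_filter. Qed.

Lemma exists_similar_cut i j : cut j ->
  exists k, [/\ i <= k, k < i + label_window, cut k & return_word k = return_word j].
Proof.
move=> cj; have RU : 0 < R + size U by lia.
have [k [ik kW e]] := lr i j RU.
have [ck _ rk] := cut_local (d := 0) e (leqnn _); rewrite !addn0 in ck rk.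
by exists k; split=> //; [rewrite /label_window; lia | rewrite ck].
Qed.

Lemma mem_return_words j : cut j -> return_word j \in return_words.
Proof.
move=> cj; have [k [_ kW ck <-]] := exists_similar_cut 0 cj.
by rewrite mem_undup; apply: map_f; rewrite mem_filter ck mem_iota.
Qed.

Definition label j := index (return_word j) return_words.

Lemma label_lt j : cut j -> label j < size return_words.
Proof. by move=> cj; rewrite index_mem mem_return_words. Qed.

Lemma nth_label j : cut j -> nth [::] return_words (label j) = return_word j.
Proof. by move=> cj; rewrite nth_index // mem_return_words. Qed.

Lemma label_inj j j' : cut j -> cut j' -> label j = label j' ->
  return_word j = return_word j'.
Proof. by move=> cj cj' e; rewrite -nth_label // e nth_label. Qed.

Lemma label_onto l : l < size return_words -> exists2 j, cut j & label j = l.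
Proof.
move=> hl; have := mem_nth [::] hl; rewrite mem_undup => /mapP[j].
rewrite mem_filter => /andP[cj _] e; exists j => //.
by rewrite /label -e index_uniq // undup_uniq.
Qed.

(** A piece of the derived sequence of [x] with respect to [U], read at the cuts in [[P, P + d)].
    Nothing relates the numberings for different [U]; [same_labels] selects exponents for which they
    agree. *)
Definition labels P d := [seq label j | j <- iota P d & cut j].

Lemma labelsD P d1 d2 : labels P (d1 + d2) = labels P d1 ++ labels (P + d1) d2.
Proof. by rewrite /labels iotaD filter_cat map_cat. Qed.

Lemma labels0 P : labels P 0 = [::].
Proof. by []. Qed.

Lemma labels_prefix P d1 d2 : d1 <= d2 -> prefix (labels P d1) (labels P d2).
Proof. by move=> /subnKC <-; rewrite labelsD prefix_prefix. Qed.

Lemma labels_local P P' W d : sl P W = sl P' W -> d.-1 + (R + size U) <= W ->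
  labels P d = labels P' d.
Proof.
move=> e hd.
have shift Q : labels Q d = [seq label (Q + k) | k <- iota 0 d & cut (Q + k)].
  by rewrite /labels -{1}(addn0 Q) iotaDl filter_map -map_comp.
have h k : k \in iota 0 d -> cut (P + k) = cut (P' + k) /\
    return_word (P + k) = return_word (P' + k).
  by rewrite mem_iota => hk; have [|-> _ ->] := @cut_local P P' W k e; first by lia.
rewrite !shift (@eq_in_filter _ _ (fun k => cut (P' + k))) => [|k /h[]//].
apply/eq_in_map => k; rewrite mem_filter => /andP[_ /h[_ e']].
by rewrite /label e'.
Qed.

Lemma mem_labels P d l : l \in labels P d -> l < size return_words.
Proof. by case/mapP=> j; rewrite mem_filter => /andP[cj _] ->; exact: label_lt. Qed.

Lemma labels_complete P d l :
  l < size return_words -> label_window <= d -> l \in labels P d.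
Proof.
move=> /label_onto[j cj <-] hd; have [k [Pk kW ck e]] := exists_similar_cut P cj.
apply/mapP; exists k; last by rewrite /label e.
by rewrite mem_filter ck mem_iota; lia.
Qed.

Lemma labels_head d : 0 < d -> labels 0 d = label 0 :: labels 1 d.-1.
Proof. by case: d => // d _; rewrite /labels /= U_prefix. Qed.

Lemma slice_labels i d : cut i -> cut (i + d) ->
  sl i d = ext (nth [::] return_words) (labels i d).
Proof.
move=> ci cd; rewrite (@cut_decomposition _ sl) //; last exact: sliceD.
rewrite /ext /labels -map_comp; congr flatten; apply/eq_in_map => j.
by rewrite mem_filter => /andP[cj _] /=; rewrite nth_label.
Qed.

Lemma size_nth_return_words l : size (nth [::] return_words l) <= R.
Proof.
case: (ltnP l (size return_words)) => hl; last by rewrite nth_default.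
have [j cj <-] := label_onto hl; rewrite nth_label // size_return_word.
by have [_ /andP[_ h] _] := next_cutP j; lia.
Qed.

Lemma size_nth_return_words_gt0 l :
  l < size return_words -> 0 < size (nth [::] return_words l).
Proof.
move=> /label_onto[j cj <-]; rewrite nth_label // size_return_word.
by have [_ /andP[h _] _] := next_cutP j; lia.
Qed.

Lemma size_labels i d : cut i -> cut (i + d) -> d <= R * size (labels i d).
Proof.
move=> ci cd; rewrite -{1}(size_slice x i d) slice_labels //.
exact: size_ext_le size_nth_return_words.
Qed.

End ReturnWords.

(** * Derived sequences *)

Lemma lift_ord_seq q (l : seq nat) : {in l, forall i, i < q} ->
  exists w : seq 'I_q, map val w = l.
Proof.
elim: l => [|i l IH] h; first by exists [::].
have [|w <-] := IH; first by move=> j jl; apply: h; rewrite inE jl orbT.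
by exists (Ordinal (h i (mem_head _ _)) :: w).
Qed.

Section DerivedSequences.

Variables (A B : finType) (s : A -> seq A) (phi : A -> seq B) (a : A) (u : seq A).
Variable x : nat -> B.
Hypothesis nf : normal_form s phi a u x.
Hypothesis aper : ~ purely_periodic x.

Local Notation len := (image_len s phi).
Local Notation y := (fixpoint s a).

Let s_gt0 := nf_gt0 nf.
Let phi_gt0 := nf_phi_gt0 nf.
Let sa := nf_start nf.
Let idem := nf_idem nf.

Let mkseq_y_prefix i : prefix (mkseq y i) (iter_word s i a).
Proof.
apply: (@prefix_of_comparable _ _ _ y); first by rewrite /prefix_of size_mkseq.
  exact: (prefix_of_fixpoint i s_gt0 sa (nf_u_gt0 nf)).
by rewrite size_mkseq ltnW // (size_iter_word_prolongable i s_gt0 sa (nf_u_gt0 nf)).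
Qed.

Let slice_y_infix i h : infix (slice y i h) (iter_word s (i + h) a).
Proof.
apply: infix_prefix_trans (mkseq_y_prefix (i + h)).
by rewrite -slice0; apply: slice_infix.
Qed.

Local Notation pos n i := (len n (mkseq y i)).
Local Notation G n := (len n [:: a]).
Local Notation Un n := (ext phi (iter_word s n a)).

Let block_slice n i h :
  slice x (pos n i) (len n (slice y i h)) = ext phi (iter n (ext s) (slice y i h)).
Proof.
have : prefix_of (ext phi (iter n (ext s) (mkseq y (i + h)))) x.
  apply: prefix_of_prefix (nf_prefix nf (n + (i + h))); apply: prefix_ext.
  by rewrite /iter_word iterD; apply: prefix_iter_ext; exact: mkseq_y_prefix.
rewrite -[mkseq y _]slice0 sliceD add0n slice0 iter_ext_cat ext_cat /prefix_of.
rewrite size_cat -slice0 sliceD add0n => /eqP.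
by rewrite eqseq_cat ?size_slice // => /andP[_ /eqP].
Qed.

Let posS n i : pos n i.+1 = pos n i + len n [:: y i].
Proof. by rewrite /mkseq -addn1 iotaD map_cat image_len_cat. Qed.

Let pos_ge n i : i <= pos n i.
Proof. by rewrite -{1}(size_mkseq y i); exact: image_len_ge. Qed.

Let Un_occ n : occ x (Un n) 0.
Proof. by apply/eqP; rewrite slice0; exact: (nf_prefix nf n). Qed.

Let G_ge n : n <= G n.
Proof. exact: (nonstationary_growth nf n (start_nonstationary nf)). Qed.

Let G_gt0 n : 0 < G n.
Proof. exact: (image_len_ge s_gt0 phi_gt0 n [:: a]). Qed.

Variables (I : nat -> Prop) (S : pred A) (c KK K L : nat).
Hypothesis I_inf : infinite I.
Hypothesis c_gt0 : 0 < c.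
Hypothesis S_big : forall b, ~~ S b -> forall n, I n -> G n <= c * len n [:: b].
Hypothesis lr : linearly_recurrent x KK.
Hypothesis ratio : forall n w, len n.+1 w <= K * len n w.
Hypothesis K_gt0 : 0 < K.
Hypothesis runs : forall n w, all S w -> infix w (iter_word s n a) -> size w <= L.

(** Any [L.+1] consecutive letters of [y] include a big one, which contributes at least
    [G n / c]. *)
Let window_len n i k : I n -> k * G n <= c * len n (slice y i (k * L.+1)).
Proof.
move=> In; elim: k i => // k IH i; rewrite !mulSn sliceD image_len_cat mulnDr.
apply: leq_add; last exact: IH.
have : ~~ all S (slice y i L.+1).
  by apply/negP=> /runs/(_ (slice_y_infix i L.+1)); rewrite size_slice ltnn.
case/allPn=> b bw nb; apply: leq_trans (S_big nb In) _.
by rewrite leq_mul2l image_len_mem ?orbT.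
Qed.

Local Notation lb n := (labels x KK (Un n)).
Let block_labels n i := lb n (pos n i) (len n [:: y i]).

(** By [window_len], [H] letters cover at least [KK.+1 * G n] positions, exactly the lookahead
    [R + size U] of [labels_local] for [U = Un n]. *)
Let H := c * KK.+1 * L.+1.

Let block_labels_window n i j : I n ->
  slice y i H.+1 = slice y j H.+1 -> block_labels n i = block_labels n j.
Proof.
move=> In e.
have e0 : y i = y j by move/eq_sliceP: e => /(_ 0 isT); rewrite !addn0.
rewrite /block_labels -e0.
apply: (@labels_local _ x KK (Un n) lr (Un_occ n) (G_gt0 n) _ _ (len n (slice y i H.+1))).
  by rewrite block_slice {2}e block_slice e.
rewrite -[H.+1]add1n sliceD addn1 image_len_cat.
have -> : slice y i 1 = [:: y i] by rewrite -[in RHS](addn0 i).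
have := window_len i.+1 (c * KK.+1) In; rewrite -/H -mulnA leq_pmul2l //.
by rewrite /return_bound -/(G n); have := G_gt0 n; nia.
Qed.

Let labels_pos n i : lb n 0 (pos n i) = flatten [seq block_labels n j | j <- iota 0 i].
Proof.
elim: i => [|i IH]; first by rewrite /mkseq image_len_nil labels0.
by rewrite posS labelsD IH -[i.+1]addn1 iotaD map_cat flatten_cat /= cats0.
Qed.

Let letter_upper n i : len n [:: y i] <= K * G n.
Proof.
have : y i \in iter_word s i a.
  by rewrite mem_nth // (size_iter_word_prolongable i s_gt0 sa (nf_u_gt0 nf)).
case: i => [|i]; first by rewrite inE => /eqP ->; rewrite leq_pmull.
rewrite alphabet_idempotent_iter // => da.
by apply: leq_trans (image_len_mem s phi n da) _; rewrite -image_lenS1.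
Qed.

(** Bounds, independent of [n], from [occ_count_scaled]: [Mb] for a block, of length at most
    [K * G n], and [Qb] for a label window, of length [KK * KK.+1 * G n]. *)
Let Mb := K * (2 * (c * KK)) + 1.
Let Qb := KK * KK.+1 * (2 * (c * KK)) + 1.

Let size_block_labels n i : c * KK <= G n -> size (block_labels n i) <= Mb.
Proof.
move=> hG; rewrite size_map size_filter.
apply: leq_trans (occ_count_scaled K (pos n i) lr aper c_gt0 hG (leq_pmull _ c_gt0)).
by rewrite -(subnKC (letter_upper n i)) iotaD count_cat leq_addr.
Qed.

Local Notation RW n := (return_words x KK (Un n)).

Let size_RW n : c * KK <= G n -> size (RW n) <= Qb.
Proof.
move=> hG; apply: leq_trans (size_return_words _ _ _) _.
have -> : label_window KK (Un n) = KK * KK.+1 * G n.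
  by rewrite /label_window /return_bound -/(G n); lia.
exact: (occ_count_scaled (KK * KK.+1) 0 lr aper c_gt0 hG (leq_pmull _ c_gt0)).
Qed.

(* The list of labels read in block [i] takes finitely many values and depends
   only on a window of [y], uniformly in [n]; hence the derived sequences for two
   exponents [n < m] coincide. *)
Let same_labels : exists J : nat -> Prop, [/\ infinite J,
  forall n, J n -> I n /\ c * KK <= G n &
  forall n m, J n -> J m -> size (RW n) = size (RW m) /\
    forall i, block_labels n i = block_labels m i].
Proof.
(* All windows of [y] already occur before [N0], so the labels of the first [N0] blocks determine
   those of every block. *)
have [N0 hN0] : exists N0, forall i, exists2 j, j < N0 & slice y i H.+1 = slice y j H.+1.
  have /fin_eventually[N hN] : forall v : H.+1.-tuple A, exists N, forall N', N <= N' ->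
      (exists i, slice y i H.+1 = v) -> exists2 j, j < N' & slice y j H.+1 = v.
    move=> v; case: (classic (exists i, slice y i H.+1 = v)) => [[i hi]|hv].
      by exists i.+1 => N' hN' _; exists i.
    by exists 0 => N' _ h; case: hv.
  exists N => i; have sz : size (slice y i H.+1) == H.+1 by rewrite size_slice.
  have [//|j jN ej] := hN (Tuple sz) N (leqnn N); first by exists i.
  by exists j.
pose data n : 'I_Qb.+1 * {ffun 'I_N0 -> Mb.-bseq 'I_Qb.+1} :=
  (inord (size (RW n)), [ffun i : 'I_N0 => insub_bseq Mb (map inord (block_labels n i))]).
pose I1 n := I n /\ c * KK <= G n.
have I1_inf : infinite I1.
  move=> N; have [n Nn In] := I_inf (N + c * KK); exists n; first by lia.
  by split=> //; apply: leq_trans (G_ge n); lia.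
have [d d_inf] := infinite_pigeonhole data I1_inf.
exists (fun n => I1 n /\ data n = d); split=> //; first by move=> n [].
move=> n m [[In Gn] en] [[Im Gm] em].
have e : data n = data m by rewrite en.
have eq1 : size (RW n) = size (RW m).
  have := congr1 (fun z => val z.1) e; rewrite /= !inordK // ltnS; exact: size_RW.
split=> // i; have [j jN ej] := hN0 i.
rewrite (block_labels_window In ej) (block_labels_window Im ej).
have dec k : c * KK <= G k -> block_labels k j =
    map val (val (insub_bseq Mb (map inord (block_labels k j) : seq 'I_Qb.+1))).
  move=> Gk; rewrite insubdK; last by rewrite -topredE /= size_map size_block_labels.
  rewrite -map_comp map_id_in // => l hl /=; rewrite inordK // ltnS.
  apply: leq_trans (size_RW Gk); apply: ltnW.
  exact: (mem_labels lr (Un_occ k) (G_gt0 k) hl).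
rewrite (dec n) // (dec m) //; congr (map val _).
have := congr1 (fun z : 'I_Qb.+1 * {ffun 'I_N0 -> Mb.-bseq 'I_Qb.+1} =>
  val (z.2 (Ordinal jN))) e.
by rewrite /= !ffunE.
Qed.

Lemma derived_primitive_substitutive : primitive_substitutive x.
Proof.
have [J [J_inf JI Jsame]] := same_labels.
have [n _ Jn] := J_inf 0; have [In Gn] := JI n Jn.
pose R := return_bound KK (Un n); pose W := label_window KK (Un n).
(* A return word for [m] longer than [X] holds at least [R.+2] return words for [n], each of length
   at most [R], and spans a label window, so it shows every label. *)
pose X := R * R.+2 + W.
(* The term [KK * X.+1] makes the return words for [m] longer than [X] by [occ_gap]; [R + G n] makes
   [Un m] as long as the lookahead for [n]. *)
have [m hm Jm] := J_inf (n + (R + G n) + KK * X.+1).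
have [Im Gm] := JI m Jm; have [eqRW eqB] := Jsame n m Jn Jm.
have KK0 := linearly_recurrent_gt0 lr.
have mG : n + (R + G n) + KK * X.+1 <= G m by apply: leq_trans hm (G_ge m).
have nm : n <= m by lia.
have cutmn j : occ x (Un m) j -> occ x (Un n) j.
  have /prefixP[v ->] : prefix (Un n) (Un m).
    by apply: prefix_ext; exact: prefix_iter_word sa nm.
  by rewrite /occ size_cat sliceD eqseq_cat ?size_slice // => /andP[].
pose nx := next_cut x KK (Un m).
have nxP j := next_cutP lr (Un_occ m) (G_gt0 m) j.
have gap j : occ x (Un m) j -> X < nx j - j.
  move=> oj; have [on /andP[h1 h2] _] := nxP j.
  have hj : j + (nx j - j) = nx j by rewrite subnKC // ltnW.
  have := @occ_gap _ x KK (Un m) j (nx j - j) lr aper.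
  rewrite subn_gt0 hj => /(_ h1 oj on) h.
  rewrite ltnNge; apply/negP=> h'.
  have : KK * (nx j - j).+1 <= KK * X.+1 by rewrite leq_mul2l ltnS h' orbT.
  by move: h; rewrite -/(G m); lia.
pose q := size (RW n).
pose th (l : 'I_q) := nth [::] (RW n) l.
(* [t] rewrites a return word for [m] in labels for [n], both alphabets being identified with
   ['I_q]. It does not depend on the chosen occurrence, because the return word is followed by
   [Un m], which contains all the lookahead needed. *)
have /fin_all_exists[t ht] : forall l : 'I_q, exists w : seq 'I_q,
    forall j, occ x (Un m) j -> label x KK (Un m) j = l -> map val w = lb n j (nx j - j).
  move=> l; have hl : l < size (RW m) by rewrite -eqRW.
  have [j oj jl] := label_onto hl.
  have [|w hw] := @lift_ord_seq q (lb n j (nx j - j)).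
    by move=> i hi; exact: (mem_labels lr (Un_occ n) (G_gt0 n) hi).
  exists w => j' oj' j'l; rewrite hw.
  have e : return_word x KK (Un m) j = return_word x KK (Un m) j'.
    by apply: (label_inj lr (Un_occ m) (G_gt0 m)) => //; rewrite jl.
  have e' : nx j - j = nx j' - j' by rewrite -!(size_return_word x KK) e.
  have ext_rw i : occ x (Un m) i ->
      slice x i (nx i - i + G m) = return_word x KK (Un m) i ++ Un m.
    move=> oi; have [/eqP on /andP[h1 _] _] := nxP i.
    rewrite sliceD subnKC ?(ltnW h1) //; congr (_ ++ _); exact: on.
  have es : slice x j (nx j - j + G m) = slice x j' (nx j - j + G m).
    by rewrite ext_rw // e' ext_rw // e.
  rewrite -e'; apply: (labels_local lr (Un_occ n) (G_gt0 n) es).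
  by rewrite -/R -/(G n); lia.
have lt0 : label x KK (Un n) 0 < q.
  exact: (label_lt lr (Un_occ n) (G_gt0 n) (Un_occ n)).
pose d0 : 'I_q := Ordinal lt0.
have lab0 : label x KK (Un m) 0 = label x KK (Un n) 0.
  have := eqB 0; rewrite /block_labels /mkseq !image_len_nil.
  have y0 : y 0 = a by [].
  rewrite y0 (labels_head KK (Un_occ n) (G_gt0 n)) (labels_head KK (Un_occ m) (G_gt0 m)).
  by case.
(* The two derived sequences agree block by block, although the blocks have different lengths. *)
have labelsE i : lb n 0 (pos n i) = lb m 0 (pos m i).
  by rewrite !labels_pos; congr flatten; apply: eq_map.
have big l : exists j,
    [/\ occ x (Un m) j, X < nx j - j & map val (t l) = lb n j (nx j - j)].
  have hl : l < size (RW m) by rewrite -eqRW.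
  have [j oj jl] := label_onto hl; exists j; split=> //; first exact: gap.
  exact: ht.
have cut_after k P : exists P', P <= P' /\ occ x (Un k) P'.
  have [on /andP[h _] _] := next_cutP lr (Un_occ k) (G_gt0 k) P.
  by exists (next_cut x KK (Un k) P); split=> //; exact: ltnW.
have tsize l : R.+2 <= size (t l).
  have [j [oj Xj tl]] := big l.
  have [on /andP[h1 _] _] := nxP j.
  have : nx j - j <= R * size (lb n j (nx j - j)).
    apply: (size_labels lr (Un_occ n) (G_gt0 n) (cutmn j oj)).
    by rewrite subnKC ?(ltnW h1) //; exact: cutmn.
  rewrite -tl size_map => h2; rewrite leqNgt; apply/negP=> h3.
  have h4 : R * size (t l) <= R * R.+2 by rewrite leq_mul2l ltnW ?orbT.
  by have := leq_trans Xj (leq_trans h2 h4); rewrite /X ltnNge leq_addr.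
have th_le l : size (th l) <= R.
  exact: (size_nth_return_words lr (Un_occ n) (G_gt0 n)).
have [v tv] : exists v, t d0 = d0 :: v.
  have nx0 : 0 < nx 0 - 0 by have [_ /andP[h _] _] := nxP 0; rewrite subn0.
  have := ht d0 0 (Un_occ m) lab0; rewrite (labels_head KK (Un_occ n) nx0).
  by case: (t d0) => // l w [e _]; exists w; congr (_ :: _); exact: val_inj.
apply: (@decorated_primitive_substitutive B 'I_q d0 t th _ _ _ _ x v tv).
- by move=> l; exact: (size_nth_return_words_gt0 lr (Un_occ n) (G_gt0 n) (ltn_ord l)).
- by move=> l; apply: leq_trans (th_le l) _; apply: leq_trans (tsize l); lia.
- by move=> l; apply: leq_trans (tsize l).
- move=> l l'; have [j [oj Xj tl]] := big l.
  rewrite -(mem_map val_inj) tl.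
  apply: (labels_complete lr (Un_occ n) (G_gt0 n) j (ltn_ord l')).
  by rewrite /X in Xj; lia.
(* The prefixes of the common derived sequence. To see that [t] preserves them, a prefix is read at
   scale [m], extended up to a cut for [m], and rewritten at scale [n]. *)
pose good (w : seq 'I_q) := exists i, prefix (map val w) (lb n 0 (pos n i)).
have lift k P : size (RW k) = q -> exists w : seq 'I_q, map val w = lb k 0 P.
  move=> ek; apply: lift_ord_seq => l hl; rewrite -ek.
  exact: (mem_labels lr (Un_occ k) (G_gt0 k) hl).
have prefix_val (w w' : seq 'I_q) : prefix (map val w) (map val w') -> prefix w w'.
  rewrite !prefixE size_map -map_take => /eqP e.
  by rewrite (inj_map val_inj e).
have good_step w : good w -> good (ext t w).
  case=> i; rewrite labelsE => hw.
  have [P [hP oP]] := cut_after m (pos m i).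
  have [w' hw'] := lift m P (esym eqRW).
  have {hw} hww' : prefix w w'.
    by apply: prefix_val; rewrite hw'; apply: prefix_trans hw _; exact: labels_prefix.
  exists P; apply: (@prefix_trans _ (lb n 0 P)); last first.
    by apply: labels_prefix; exact: pos_ge.
  apply: (@prefix_trans _ (map val (ext t w'))).
    by have /prefixP[z ->] := prefix_ext t hww'; rewrite map_cat prefix_prefix.
  rewrite (_ : map val (ext t w') = lb n 0 P) ?prefix_refl //.
  rewrite (@cut_decomposition _ x KK (Un m) lr (Un_occ m) (G_gt0 m) _ (lb n)) //;
    last exact: labelsD.
  rewrite /ext map_flatten -map_comp; congr flatten.
  rewrite /labels in hw'.
  elim: [seq _ <- _ | _] w' hw' {hww'} (filter_all (occ x (Un m)) (iota 0 P)).
    by case.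
  move=> j l IH [|z w'] //= [ez ew] /andP[oj al].
  by rewrite (IH w' ew al) (ht z j oj) ?ez.
move=> k; have : good (iter_word t k d0).
  elim: k => [|k IH]; last by rewrite /iter_word iterS; exact: good_step.
  exists 1; rewrite posS /mkseq image_len_nil labels_head ?G_gt0 //=.
  by rewrite eqxx prefix0s.
case=> i hw; have [P [hP oP]] := cut_after n (pos n i).
have [w' hw'] := lift n P erefl.
have hww' : prefix (iter_word t k d0) w'.
  by apply: prefix_val; rewrite hw'; apply: prefix_trans hw _; exact: labels_prefix.
apply: prefix_of_prefix (prefix_ext th hww') _.
have -> : ext th w' = slice x 0 P.
  rewrite (slice_labels lr (Un_occ n) (G_gt0 n) (Un_occ n)) // -hw'.
  by rewrite /ext -map_comp.
by rewrite /prefix_of size_slice slice0.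
Qed.

End DerivedSequences.

Theorem theorem3 (B : finType) (x : nat -> B) :
  uniformly_recurrent x -> morphic x -> primitive_substitutive x.
Proof.
move=> ur /morphic_normal_form[A [s [phi [a [u nf]]]]].
case: (classic (purely_periodic x)) => [|aper].
  exact: purely_periodic_primitive_substitutive.
have [K K_gt0 ratio] := image_len_ratio (nf_gt0 nf) (nf_phi_gt0 nf).
have [KK lr] := exists_linearly_recurrent nf ur aper.
have [I [S [I_inf I_u S_small [c c_gt0 S_big]]]] := big_or_small nf ur aper.
have [L runs] := small_runs_bounded nf ur aper I_inf I_u S_small c_gt0 S_big.
apply: (derived_primitive_substitutive nf aper I_inf c_gt0 S_big lr _ K_gt0 runs).
by move=> n w; have [] := ratio n w.
Qed.
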